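(* Let $K$ be a field of characteristic zero and $A_1=A_1(K)$ the first Weyl algebra. The following two statements are equivalent: (i) (Dixmier conjecture) every $K$-algebra endomorphism of $A_1$ is an automorphism of $A_1$; (ii) ($\gamma,\delta$ conjecture, first version) for every $K$-algebra endomorphism $f$ of $A_1$ there exist involutions $\gamma$ and $\delta$ on $A_1$, each of them conjugate to $\alpha$, such that $f$ is a $\gamma,\delta$-endomorphism of $A_1$, i.e. $f\circ\gamma=\delta\circ f$.
   Context: $A_1=K\langle X,Y\mid YX-XY=1\rangle$. Endomorphisms, automorphisms, anti-endomorphisms and anti-automorphisms are $K$-linear and unital. An involution on $A_1$ is a $K$-linear anti-automorphism of order $2$. The exchange involution $\alpha$ is given by $\alpha(X)=Y$, $\alpha(Y)=X$. An involution $\gamma$ on $A_1$ is conjugate to $\alpha$ if $\gamma=g^{-1}\circ\alpha\circ g$ for some automorphism or anti-automorphism $g$ of $A_1$. For involutions $\gamma,\delta$ on $A_1$, an endomorphism $f$ of $A_1$ is a $\gamma,\delta$-endomorphism if $f\circ\gamma=\delta\circ f$. *)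

(* Defs.v *)
From HB Require Import structures.
From mathcomp Require Import all_boot all_order all_algebra.
From mathcomp Require Import ring_quotient finmap monalg boolp.

Set Implicit Arguments.
Unset Strict Implicit.
Unset Printing Implicit Defensive.

Import GRing.Theory.

Local Open Scope ring_scope.
Local Open Scope quotient_scope.

(* The library only makes the converse of a ring a ring; the converse of an
   algebra is an algebra with the same scaling. *)
HB.instance Definition _ (K : pzRingType) (A : algType K) :=
  GRing.Lmodule.on A^c.
HB.instance Definition _ (K : pzRingType) (A : algType K) :=
  GRing.Lmodule_isLalgebra.Build K A^c (fun k u v => @scalerAr K A k v u).
HB.instance Definition _ (K : pzRingType) (A : algType K) :=
  GRing.Lalgebra_isAlgebra.Build K A^c (fun k u v => @scalerAl K A k v u).

(* The two-sided ideal of R generated by r. *)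
Section TwoSidedIdeal.
Variables (R : nzRingType) (r : R).

Definition two_sided_ideal : {pred R} := fun p =>
  `[< exists s : seq (R * R), p = \sum_(u <- s) u.1 * r * u.2 >].

Lemma two_sided_idealP p :
  reflect (exists s : seq (R * R), p = \sum_(u <- s) u.1 * r * u.2)
          (p \in two_sided_ideal).
Proof. exact: asboolP. Qed.

Lemma two_sided_ideal_zmod_closed : zmod_closed two_sided_ideal.
Proof.
split=> [|p q /two_sided_idealP[s ->] /two_sided_idealP[t ->]];
  apply/two_sided_idealP.
  by exists [::]; rewrite big_nil.
exists (s ++ [seq (- u.1, u.2) | u <- t]).
rewrite big_cat big_map /= -sumrN; congr (_ + _).
by apply: eq_bigr => u _; rewrite !mulNr.
Qed.
HB.instance Definition _ :=
  GRing.isZmodClosed.Build R two_sided_ideal two_sided_ideal_zmod_closed.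

Lemma two_sided_idealMl a p : p \in two_sided_ideal -> a * p \in two_sided_ideal.
Proof.
move=> /two_sided_idealP[s ->]; apply/two_sided_idealP.
exists [seq (a * u.1, u.2) | u <- s]; rewrite big_map mulr_sumr.
by apply: eq_bigr => u _; rewrite !mulrA.
Qed.

Lemma two_sided_idealMr a p : p \in two_sided_ideal -> p * a \in two_sided_ideal.
Proof.
move=> /two_sided_idealP[s ->]; apply/two_sided_idealP.
exists [seq (u.1, u.2 * a) | u <- s]; rewrite big_map mulr_suml.
by apply: eq_bigr => u _; rewrite !mulrA.
Qed.

Lemma mem_two_sided_ideal : r \in two_sided_ideal.
Proof.
by apply/two_sided_idealP; exists [:: (1, 1)]; rewrite big_seq1 mulr1 mul1r.
Qed.

Lemma two_sided_ideal_mul p p' q q' :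
  p - p' \in two_sided_ideal -> q - q' \in two_sided_ideal ->
  p * q - p' * q' \in two_sided_ideal.
Proof.
move=> pI qI; rewrite -[p * q](addrNK (p * q')) -mulrBr -addrA -mulrBl.
by apply: rpredD; [apply: two_sided_idealMl | apply: two_sided_idealMr].
Qed.

End TwoSidedIdeal.

(* Computations in an abstract ring, as rewriting in the free algebra is slow. *)
Section AbstractComputations.
Variables (R : nzRingType).

Lemma mulr_comm_l (c u v : R) : c * u = u * c -> c * (u * v) = u * (c * v).
Proof. by move=> cu; rewrite mulrA cu mulrA. Qed.

Lemma rmorph_rel (S : nzRingType) (f : {rmorphism R -> S}) (r x y : R) :
  r = y * x - x * y - 1 -> f r = f y * f x - f x * f y - 1.
Proof. by move=> ->; rewrite !rmorphB !rmorphM rmorph1. Qed.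

Lemma act_rel (V : zmodType) (act : R -> V -> V) (r x y : R) :
    (forall p q v, act (p - q) v = act p v - act q v) ->
    (forall p q v, act (p * q) v = act p (act q v)) ->
    (forall v, act 1 v = v) ->
  r = y * x - x * y - 1 ->
  forall v, act r v = act y (act x v) - act x (act y v) - v.
Proof. by move=> actB actM act1 -> v; rewrite !actB !actM act1. Qed.

End AbstractComputations.

(* The free algebra K<X, Y>, as the monoid algebra of the words in the two
   letters false (for X) and true (for Y). *)
Notation free2 K := {malg K[{fmonom bool}]}.

Section FreeAlgebra.
Variable K : fieldType.
Local Notation F := (free2 K).

(* Generators are locked to keep unification from unfolding them. *)
Definition freeX : F := locked (mkmalgU (fmu false) 1).
Definition freeY : F := locked (mkmalgU (fmu true) 1).

Lemma freeXE : freeX = mkmalgU (fmu false) 1.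
Proof. by rewrite /freeX -lock. Qed.

Lemma freeYE : freeY = mkmalgU (fmu true) 1.
Proof. by rewrite /freeY -lock. Qed.

Lemma free_scalerAr (k : K) (u v : F) : k *: (u * v) = u * (k *: v).
Proof.
have kC : malgC k * u = u * malgC k.
  rewrite !malgM_def fgmulUg fgmulgU; apply: eq_bigr => i _.
  by rewrite mulrC mul1m mulm1.
rewrite -(mul_malgC k (u * v)) -(mul_malgC k v); exact: mulr_comm_l kC.
Qed.

Definition word_eval (R : nzRingType) (x y : R) (m : {fmonom bool}) : R :=
  \prod_(b <- (m : seq bool)) (if b then y else x).

Lemma word_eval_mmorphism (R : nzRingType) (x y : R) :
  mmorphism (word_eval x y).
Proof.
split=> [m1 m2|]; first by rewrite /word_eval fmM big_cat.
by rewrite /word_eval fm1 big_nil.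
Qed.

HB.instance Definition _ (R : nzRingType) (x y : R) :=
  isMultiplicative.Build _ R (word_eval x y) (word_eval_mmorphism x y).

Section FreeEval.
Variables (B : algType K) (x y : B).

Definition free_eval : F -> B := mmap (in_alg B) (word_eval x y).

Lemma free_eval_additive : zmod_morphism free_eval.
Proof. exact: raddfB. Qed.
HB.instance Definition _ :=
  GRing.isZmodMorphism.Build F B free_eval free_eval_additive.

Lemma free_eval_multiplicative : monoid_morphism free_eval.
Proof.
have [|fM f1] := @commr_mmap_is_multiplicative _ K B (in_alg B) (word_eval x y).
  by move=> g m m'; rewrite /GRing.comm /= mulr_algl mulr_algr.
by split.
Qed.
HB.instance Definition _ :=
  GRing.isMonoidMorphism.Build F B free_eval free_eval_multiplicative.

Lemma free_eval_scalable : scalable free_eval.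
Proof. by move=> k p; rewrite /free_eval mmapZ /= mulr_algl. Qed.
HB.instance Definition _ :=
  GRing.isScalable.Build K F B *:%R free_eval free_eval_scalable.

Lemma free_evalX : free_eval freeX = x.
Proof.
by rewrite freeXE /free_eval mmapU /= scale1r mul1r /word_eval fmU big_seq1.
Qed.

Lemma free_evalY : free_eval freeY = y.
Proof.
by rewrite freeYE /free_eval mmapU /= scale1r mul1r /word_eval fmU big_seq1.
Qed.

End FreeEval.

Lemma free_eval_unique (B : algType K) (f : {lrmorphism F -> B}) :
  f =1 free_eval (f freeX) (f freeY).
Proof.
move=> p; rewrite [p]monalgE !raddf_sum /=; apply: eq_bigr => m _.
have -> : mkmalgU m p@_m = p@_m *: mkmalgU m 1 :> F.
  by apply/malgP => i; rewrite mcoeffZ !mcoeffU mulrnAr mulr1.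
rewrite !linearZ /=; congr (_ *: _).
rewrite -(fmK m); elim: (m : seq bool) => [|b s IHs].
  have -> : mkmalgU (FMonom [::]) 1 = 1 :> F by rewrite -fmoneE.
  by rewrite !rmorph1.
have -> : mkmalgU (FMonom (b :: s)) 1
    = (if b then freeY else freeX) * mkmalgU (FMonom s) 1 :> F.
  by rewrite freeXE freeYE; case: b; rewrite malgM_def fgmulUU mulr1;
    congr mkmalgU; apply/val_inj; rewrite /= fmM fmU.
by rewrite !rmorphM /= IHs; case: b; rewrite ?free_evalX ?free_evalY.
Qed.

(* The defining relation, as the element YX - XY - 1. *)
Definition weyl_rel : F := locked (freeY * freeX - freeX * freeY - 1).

Lemma weyl_relE : weyl_rel = freeY * freeX - freeX * freeY - 1.
Proof. by rewrite /weyl_rel -lock. Qed.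

Definition weyl_ideal : {pred F} := two_sided_ideal weyl_rel.
HB.instance Definition _ := GRing.ZmodClosed.on weyl_ideal.

Lemma weyl_idealZ (k : K) p : p \in weyl_ideal -> k *: p \in weyl_ideal.
Proof. by rewrite -mul_malgC; apply: two_sided_idealMl. Qed.

(* The ideal is proper: K<X, Y> acts on K[t] by X = t and Y = d/dt, and the
   ideal acts by zero. *)
Definition letter_act (b : bool) (f : {poly K}) : {poly K} :=
  if b then f^`() else 'X * f.

Definition word_act (m : {fmonom bool}) (f : {poly K}) : {poly K} :=
  foldr letter_act f m.

Definition free_act (p : F) (f : {poly K}) : {poly K} :=
  mmap (@polyC K) (word_act^~ f) p.

Lemma word_actB m : {morph word_act m : f g / f - g}.
Proof.
move=> f g; rewrite /word_act; elim: (m : seq bool) => //= b s ->.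
by case: b; rewrite /letter_act ?derivB ?mulrBr.
Qed.

Lemma word_act0 m : word_act m 0 = 0.
Proof. by rewrite -(subrr 0) word_actB !subrr. Qed.

Lemma word_actD m : {morph word_act m : f g / f + g}.
Proof.
by move=> f g; rewrite -{1}[g]opprK -[- g]sub0r !word_actB word_act0 sub0r opprK.
Qed.

Lemma word_actZ m (c : K) f : word_act m (c *: f) = c *: word_act m f.
Proof.
rewrite /word_act; elim: (m : seq bool) => //= b s ->.
by case: b; rewrite /letter_act ?derivZ ?scalerAr.
Qed.

Lemma free_actB p q f : free_act (p - q) f = free_act p f - free_act q f.
Proof. exact: raddfB. Qed.

Lemma free_act_sum (I : Type) (r : seq I) (p : I -> F) f :
  free_act (\sum_(i <- r) p i) f = \sum_(i <- r) free_act (p i) f.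
Proof. exact: raddf_sum. Qed.

Lemma free_actU m c f : free_act (mkmalgU m c) f = c *: word_act m f.
Proof. by rewrite /free_act mmapU mul_polyC. Qed.

Lemma free_actE p f : free_act p f = \sum_(m <- msupp p) p@_m *: word_act m f.
Proof. by rewrite /free_act mmapE; apply: eq_bigr => m _; rewrite mul_polyC. Qed.

Lemma free_actM p q f : free_act (p * q) f = free_act p (free_act q f).
Proof.
rewrite malgME free_act_sum [RHS]free_actE; apply: eq_bigr => m _.
rewrite free_act_sum free_actE.
rewrite (big_morph (word_act m) (word_actD m) (word_act0 m)) scaler_sumr.
apply: eq_bigr => n _; rewrite free_actU word_actZ scalerA; congr (_ *: _).
by rewrite /word_act fmM foldr_cat.
Qed.

Lemma free_act1 f : free_act 1 f = f.
Proof. by rewrite free_actU scale1r /word_act fm1. Qed.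

Lemma free_act_rel f : free_act weyl_rel f = 0.
Proof.
have -> := act_rel free_actB free_actM free_act1 weyl_relE f.
rewrite freeXE freeYE !free_actU !scale1r /word_act !fmU /=.
by rewrite derivM derivX mul1r addrK subrr.
Qed.

Lemma free_act0 p : free_act p 0 = 0.
Proof.
by rewrite free_actE big1 // => m _; rewrite word_act0 scaler0.
Qed.

Lemma weyl_ideal1 : 1 \notin weyl_ideal.
Proof.
apply/two_sided_idealP => -[s /(congr1 (free_act^~ 1))]; rewrite free_act1.
rewrite free_act_sum big1 => [/eqP|u _]; first by rewrite oner_eq0.
by rewrite !free_actM free_act_rel free_act0.
Qed.

(* The first Weyl algebra K<X, Y | YX - XY = 1>. *)
Definition weyl := Quotient.quot weyl_ideal.

HB.instance Definition _ := GRing.Zmodule.on weyl.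
HB.instance Definition _ : EqQuotient F (Quotient.equiv weyl_ideal) weyl :=
  EqQuotient.on weyl.
HB.instance Definition _ := @isZmodQuotient.Build F (Quotient.equiv weyl_ideal)
  0 -%R +%R weyl (lock _) (@Quotient.pi_opp _ _) (@Quotient.pi_add _ _).

Lemma weyl_eqP (p q : F) :
  reflect (\pi_weyl p = \pi_weyl q) (p - q \in weyl_ideal).
Proof. by rewrite Quotient.idealrBE; apply: eqP. Qed.

Definition weyl_one : weyl := lift_cst weyl 1.
Definition weyl_mul := lift_op2 weyl *%R.
Definition weyl_scale (k : K) := lift_op1 weyl ( *:%R k).

Canonical pi_weyl_one := PiConst weyl_one.

Lemma pi_weyl_oneE : \pi_weyl 1 = weyl_one.
Proof. by rewrite piE. Qed.

Lemma pi_weyl_mul : {morph \pi_weyl : p q / p * q >-> weyl_mul p q}.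
Proof.
move=> p q; unlock weyl_mul; apply/weyl_eqP.
by apply: two_sided_ideal_mul; apply/weyl_eqP; rewrite reprK.
Qed.
Canonical pi_weyl_mul_morph := PiMorph2 pi_weyl_mul.

Lemma pi_weyl_scale k : {morph \pi_weyl : p / k *: p >-> weyl_scale k p}.
Proof.
move=> p; unlock weyl_scale; apply/weyl_eqP.
by rewrite -scalerBr; apply/weyl_idealZ/weyl_eqP; rewrite reprK.
Qed.
Canonical pi_weyl_scale_morph k := PiMorph1 (pi_weyl_scale k).

Lemma weyl_mulA : associative weyl_mul.
Proof. by move=> x y z; rewrite -[x]reprK -[y]reprK -[z]reprK !piE mulrA. Qed.

Lemma weyl_mul1l : left_id weyl_one weyl_mul.
Proof. by move=> x; rewrite -[x]reprK !piE mul1r. Qed.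

Lemma weyl_mul1r : right_id weyl_one weyl_mul.
Proof. by move=> x; rewrite -[x]reprK !piE mulr1. Qed.

Lemma weyl_mulDl : left_distributive weyl_mul +%R.
Proof.
by move=> x y z; rewrite -[x]reprK -[y]reprK -[z]reprK !piE mulrDl.
Qed.

Lemma weyl_mulDr : right_distributive weyl_mul +%R.
Proof.
by move=> x y z; rewrite -[x]reprK -[y]reprK -[z]reprK !piE mulrDr.
Qed.

Lemma weyl_one_neq0 : weyl_one != 0.
Proof.
by rewrite !piE /Quotient.equiv subr0 weyl_ideal1.
Qed.

HB.instance Definition _ := GRing.Zmodule_isNzRing.Build weyl
  weyl_mulA weyl_mul1l weyl_mul1r weyl_mulDl weyl_mulDr weyl_one_neq0.

Lemma weyl_scaleA k l x : weyl_scale k (weyl_scale l x) = weyl_scale (k * l) x.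
Proof. by rewrite -[x]reprK !piE scalerA. Qed.

Lemma weyl_scale1 : left_id 1 weyl_scale.
Proof. by move=> x; rewrite -[x]reprK !piE scale1r. Qed.

Lemma weyl_scaleDr : right_distributive weyl_scale +%R.
Proof. by move=> k x y; rewrite -[x]reprK -[y]reprK !piE scalerDr. Qed.

Lemma weyl_scaleDl x : {morph weyl_scale^~ x : k l / k + l}.
Proof. by move=> k l; rewrite -[x]reprK !piE scalerDl. Qed.

HB.instance Definition _ := GRing.Zmodule_isLmodule.Build K weyl
  weyl_scaleA weyl_scale1 weyl_scaleDr weyl_scaleDl.

Lemma weyl_scaleAl (k : K) (x y : weyl) : k *: (x * y) = k *: x * y.
Proof.
rewrite -[x]reprK -[y]reprK.
by rewrite /GRing.scale /GRing.mul /= !piE scalerAl.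
Qed.
HB.instance Definition _ :=
  GRing.Lmodule_isLalgebra.Build K weyl weyl_scaleAl.

Lemma weyl_scaleAr (k : K) (x y : weyl) : k *: (x * y) = x * (k *: y).
Proof.
rewrite -[x]reprK -[y]reprK.
by rewrite /GRing.scale /GRing.mul /= !piE free_scalerAr.
Qed.
HB.instance Definition _ :=
  GRing.Lalgebra_isAlgebra.Build K weyl weyl_scaleAr.

Definition weyl_pi (p : F) : weyl := \pi_weyl p.

Lemma weyl_pi_additive : zmod_morphism weyl_pi.
Proof. by move=> p q; rewrite /weyl_pi !piE. Qed.
HB.instance Definition _ :=
  GRing.isZmodMorphism.Build F weyl weyl_pi weyl_pi_additive.

Lemma weyl_pi_multiplicative : monoid_morphism weyl_pi.
Proof. by split=> [|p q]; [exact: pi_weyl_oneE | exact: pi_weyl_mul]. Qed.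
HB.instance Definition _ :=
  GRing.isMonoidMorphism.Build F weyl weyl_pi weyl_pi_multiplicative.

Lemma weyl_pi_scalable : scalable weyl_pi.
Proof. by move=> k p; rewrite /weyl_pi pi_weyl_scale. Qed.
HB.instance Definition _ :=
  GRing.isScalable.Build K F weyl *:%R weyl_pi weyl_pi_scalable.

Definition weylX : weyl := locked (\pi_weyl freeX).
Definition weylY : weyl := locked (\pi_weyl freeY).

Lemma weylXE : weylX = weyl_pi freeX.
Proof. by rewrite /weylX -lock. Qed.

Lemma weylYE : weylY = weyl_pi freeY.
Proof. by rewrite /weylY -lock. Qed.

Lemma weyl_relation : weylY * weylX - weylX * weylY = 1.
Proof.
apply/eqP; rewrite -subr_eq0 weylXE weylYE -!rmorphM -!rmorphB.
rewrite -(rmorph1 weyl_pi) -rmorphB -weyl_relE -(rmorph0 weyl_pi).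
by apply/eqP/weyl_eqP; rewrite subr0; exact: mem_two_sided_ideal.
Qed.

(* Evaluation at (x, y), through an arbitrary representative in K<X, Y>; it is
   well defined, and an algebra morphism, as soon as yx - xy = 1. *)
Definition weyl_eval (B : algType K) (x y : B) (a : weyl) : B :=
  locked (free_eval x y) (repr a).

Section WeylEval.
Variables (B : algType K) (x y : B).

Lemma weyl_evalE a : weyl_eval x y a = free_eval x y (repr a).
Proof. by rewrite /weyl_eval -lock. Qed.

Hypothesis yx : y * x - x * y = 1.

Lemma free_eval_rel : free_eval x y weyl_rel = 0.
Proof.
have -> := rmorph_rel (free_eval x y) weyl_relE.
by rewrite /= free_evalX free_evalY yx subrr.
Qed.

Lemma free_eval_ideal p : p \in weyl_ideal -> free_eval x y p = 0.
Proof.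
move=> /two_sided_idealP[s ->]; rewrite raddf_sum big1 //= => u _.
by rewrite 2!rmorphM /= free_eval_rel mulr0 mul0r.
Qed.

Lemma weyl_eval_pi p : weyl_eval x y (weyl_pi p) = free_eval x y p.
Proof.
apply/eqP; rewrite weyl_evalE -subr_eq0 -raddfB.
apply/eqP/free_eval_ideal/weyl_eqP.
by rewrite reprK.
Qed.

Lemma weyl_piK a : weyl_pi (repr a) = a.
Proof. exact: reprK. Qed.

Lemma weyl_evalX : weyl_eval x y weylX = x.
Proof. by rewrite weylXE weyl_eval_pi free_evalX. Qed.

Lemma weyl_evalY : weyl_eval x y weylY = y.
Proof. by rewrite weylYE weyl_eval_pi free_evalY. Qed.

Lemma weyl_eval_linear : linear (weyl_eval x y).
Proof.
move=> k a b; rewrite -{1}[a]weyl_piK -{1}[b]weyl_piK.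
by rewrite -linearP weyl_eval_pi linearP !weyl_evalE.
Qed.

Lemma weyl_eval_multiplicative : monoid_morphism (weyl_eval x y).
Proof.
split=> [|a b]; first by rewrite -(rmorph1 weyl_pi) weyl_eval_pi rmorph1.
by rewrite -{1}[a]weyl_piK -{1}[b]weyl_piK -rmorphM weyl_eval_pi rmorphM !weyl_evalE.
Qed.

End WeylEval.

Lemma weyl_morph_unique (B : algType K) (f g : {lrmorphism weyl -> B}) :
  f weylX = g weylX -> f weylY = g weylY -> f =1 g.
Proof.
move=> eqX eqY a; rewrite -[a]weyl_piK.
rewrite -[LHS]/((f \o weyl_pi) (repr a)) -[RHS]/((g \o weyl_pi) (repr a)).
by rewrite [LHS]free_eval_unique [RHS]free_eval_unique /= -weylXE -weylYE eqX eqY.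
Qed.

(* The exchange involution is the algebra morphism from weyl to its converse
   with X |-> Y and Y |-> X. *)
Definition exchange (a : weyl) : weyl :=
  @weyl_eval weyl^c weylY weylX a.

Lemma exchangeX : exchange weylX = weylY.
Proof. exact: (@weyl_evalX weyl^c weylY weylX weyl_relation). Qed.

Lemma exchangeY : exchange weylY = weylX.
Proof. exact: (@weyl_evalY weyl^c weylY weylX weyl_relation). Qed.

End FreeAlgebra.

Section Involutions.
Variables (K : fieldType) (A : algType K).
Implicit Types f g : A -> A.

Definition algebra_automorphism g : Prop :=
  [/\ linear g, g 1 = 1, {morph g : x y / x * y} & bijective g].

Definition algebra_antiautomorphism g : Prop :=
  [/\ linear g, g 1 = 1, {morph g : x y / x * y >-> y * x} & bijective g].

Definition is_involution g : Prop :=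
  [/\ algebra_antiautomorphism g, g \o g =1 id & ~ (g =1 id)].

Definition conjugate_to (f0 f : A -> A) : Prop :=
  exists g ginv : A -> A,
    [/\ algebra_automorphism g \/ algebra_antiautomorphism g,
        cancel g ginv, cancel ginv g & f =1 ginv \o f0 \o g].

End Involutions.

Section Exchange.
Variable K : fieldType.
Local Notation A1 := (weyl K).

Lemma exchange_linear : linear (@exchange K).
Proof.
exact: (@weyl_eval_linear K (A1^c) (weylY K) (weylX K) (weyl_relation K)).
Qed.

Lemma exchange1 : exchange 1 = 1 :> A1.
Proof.
exact: (@weyl_eval_multiplicative K (A1^c) (weylY K) (weylX K)
  (weyl_relation K)).1.
Qed.

Lemma exchangeM (a b : A1) : exchange (a * b) = exchange b * exchange a.
Proof.
have [_ eM] := @weyl_eval_multiplicative K (A1^c) (weylY K) (weylX K)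
  (weyl_relation K).
by rewrite /exchange eM.
Qed.

Lemma exchangeK : involutive (@exchange K).
Proof.
pose e2 : A1 -> A1 := @exchange K \o @exchange K.
have e2L : linear e2 by move=> k a b; rewrite /e2 /= !exchange_linear.
have e2M : monoid_morphism e2.
  by split=> [|a b]; rewrite /e2 /= ?exchange1 // !exchangeM.
pose e2lin := GRing.isLinear.Build K A1 A1 *:%R e2 e2L.
pose e2mon := GRing.isMonoidMorphism.Build A1 A1 e2 e2M.
pose e2lr : {lrmorphism A1 -> A1} := HB.pack e2 e2lin e2mon.
have := @weyl_morph_unique K A1 e2lr idfun; apply.
  by rewrite /= /e2 /= exchangeX exchangeY.
by rewrite /= /e2 /= exchangeY exchangeX.
Qed.

Lemma exchange_is_involution : is_involution (@exchange K).
Proof.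
split; [split | exact: exchangeK |].
- exact: exchange_linear.
- exact: exchange1.
- exact: exchangeM.
- exact: inv_bij exchangeK.
move=> /(_ (weylX K)); rewrite exchangeX => YX.
have := weyl_relation K; rewrite YX subrr => /eqP.
by rewrite eq_sym oner_eq0.
Qed.

End Exchange.

(* Main.v *)
Require Import Defs.
From HB Require Import structures.
From mathcomp Require Import all_boot all_order all_algebra.
From mathcomp Require Import ring_quotient boolp classical_sets.
From mathcomp Require Import ring lra zify.
Set Implicit Arguments.
Unset Strict Implicit.
Unset Printing Implicit Defensive.
Import Order.TTheory GRing.Theory Num.Theory.
Local Open Scope ring_scope.

(** If every endomorphism f is an automorphism, then gamma := exchange and
    delta := f o exchange o f^-1 do.

    For the converse, conjugation by the exchange involution is trivial on the
    exchange involution itself, so gamma and delta may be taken conjugate to it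
    by automorphisms g and h, and then h o f o g^-1 is an endomorphism commuting
    with the exchange.  Hence everything rests on the statement that such an
    endomorphism is bijective ([exchange_endomorphism_bijective]).

    Take the generators u = X + Y and v = (Y - X) / 2, so that vu - uv = 1 and
    the exchange fixes u and negates v; it is the formal adjoint of differential
    operators in u.  Put S = f(u) and D = f(v): then DS - SD = 1 and D is skew
    for the adjoint.  The heart of the proof ([skew_partner_order_one]) is that a
    skew D with such a partner S is a scalar multiple c v of v.  Once this is
    known, S - u / c commutes with v, hence is a polynomial in v, and f is
    visibly invertible.

    To prove the claim, reduce modulo a large prime p.  The coefficients of D and
    S generate a ring A in which only finitely many primes are invertible
    ([few_prime_units_fg]), so p may be chosen with R := A / p nonzero.  Over R,
    the powers D^p and S^p are central ([weyl_pow_central]): multiplication by D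
    is a matrix of size p over a commutative ring, and differentiating the
    Cayley-Hamilton identity by means of [D, S] = 1 kills all coefficients of the
    characteristic polynomial but the extreme ones.  The centre is the polynomial
    ring in u^p and v^p ([centralP]), so D^p and S^p are polynomials d and s in
    two variables U and V.  The commutator of lifts to A, divided by p, is a
    Poisson bracket on the centre; since [y^p, x^p] is congruent to p! modulo p^2
    whenever [y, x] = 1, the Jacobian of (d, s) is 1 ([centre_jacobian]).

    The question has become commutative: over a residue field of R, the
    polynomials d and s have Jacobian 1, their degrees are small compared with p,
    and d is odd in V because D is skew.  On the line V = 0 the Jacobian reads
    d_1(U) s_0'(U) = 1, so that s_0 has degree 1 and d_1 is constant.  Now give U
    the weight 1 and V the weight t, and let t grow from minus infinity as long
    as U and V dominate s and d.  At the first t where another monomial catches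
    up, the extreme monomials of s and d must have proportional exponents, since
    otherwise their bracket is a monomial of the Jacobian other than 1; as d is
    odd in V, this leaves only d = c V ([corner_rigidity]).  Therefore D has order
    one with constant leading coefficient, and a skew such operator is a multiple
    of v. *)

(** * The Weyl algebra over a commutative ring *)

(** Normally ordered operators: the outer variable is the derivation v, the
    inner variable the coordinate u, and coefficients stand on the left of the
    powers of v.  The type carries its own ring structure, different from that
    of [{poly {poly R}}]. *)
Definition diffop (R : comNzRingType) : Type := {poly {poly R}}.

Section DiffOp.
Variable R : comNzRingType.
Local Notation W := (diffop R).
Implicit Types (p q r : {poly {poly R}}) (a : {poly R}).

HB.instance Definition _ := GRing.Zmodule.on W.

Definition inner_deriv q : {poly {poly R}} := map_poly (@deriv R) q.

(** Left multiplication by v, that is v a = a v + a'. *)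
Definition dmul q : {poly {poly R}} := q * 'X + inner_deriv q.

Definition op_mul p q : {poly {poly R}} :=
  \sum_(b < size p) p`_b *: iter b dmul q.

Lemma inner_derivE q j : (inner_deriv q)`_j = (q`_j)^`().
Proof. by rewrite coef_map_id0 // deriv0. Qed.

Lemma inner_derivZ a q :
  inner_deriv (a *: q) = a^`() *: q + a *: inner_deriv q.
Proof.
by apply/polyP=> j; rewrite coefD !coefZ !inner_derivE coefZ derivM.
Qed.

Lemma inner_derivMX q : inner_deriv (q * 'X) = inner_deriv q * 'X.
Proof.
by apply/polyP=> -[|j]; rewrite inner_derivE !coefMX /= ?deriv0 // inner_derivE.
Qed.

Lemma inner_derivD : {morph inner_deriv : p q / p + q}.
Proof.
by move=> p q; apply/polyP=> j; rewrite coefD !inner_derivE coefD derivD.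
Qed.

Lemma dmulD : {morph dmul : p q / p + q}.
Proof. by move=> p q; rewrite /dmul mulrDl inner_derivD addrACA. Qed.

Lemma dmul0 : dmul 0 = 0.
Proof. by apply: (addIr (dmul 0)); rewrite -dmulD !add0r. Qed.

Lemma dmulZ a q : dmul (a *: q) = a *: dmul q + a^`() *: q.
Proof.
by rewrite /dmul inner_derivZ scalerDr -scalerAl (addrC (a^`() *: q)) addrA.
Qed.

Lemma dmulMX q : dmul (q * 'X) = dmul q * 'X.
Proof. by rewrite /dmul inner_derivMX mulrDl. Qed.

Lemma iter_dmulD n : {morph iter n dmul : p q / p + q}.
Proof. by move=> p q; elim: n => //= n ->; rewrite dmulD. Qed.

Lemma iter_dmulMX n q : iter n dmul (q * 'X) = iter n dmul q * 'X.
Proof. by elim: n => //= n ->; rewrite dmulMX. Qed.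

Lemma iter_dmulZC n (k : R) q : iter n dmul (k%:P *: q) = k%:P *: iter n dmul q.
Proof. by elim: n => //= n ->; rewrite dmulZ derivC scale0r addr0. Qed.

Lemma iter_dmul1 n : iter n dmul 1 = 'X^n.
Proof.
elim: n => //= n ->; rewrite /dmul exprSr -[RHS]addr0; congr (_ + _).
apply/polyP=> j; rewrite inner_derivE coefXn coef0.
by case: eqP => _; rewrite ?derivC // deriv0.
Qed.

Lemma op_mul_wide n p q : (size p <= n)%N ->
  op_mul p q = \sum_(b < n) p`_b *: iter b dmul q.
Proof.
move=> le_pn; rewrite /op_mul (big_ord_widen n (fun b => p`_b *: iter b dmul q)) //.
rewrite big_mkcond; apply: eq_bigr => b _; case: ltnP => // le_pb.
by rewrite nth_default // scale0r.
Qed.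

Lemma op_mulDl : left_distributive op_mul +%R.
Proof.
move=> p q r; set n := maxn (size p) (size q).
have le_n := size_polyD p q.
rewrite !(@op_mul_wide n) ?leq_maxl ?leq_maxr // -big_split /=.
by apply: eq_bigr => b _; rewrite coefD scalerDl.
Qed.

Lemma op_mulDr : right_distributive op_mul +%R.
Proof.
move=> p q r; rewrite -big_split /=; apply: eq_bigr => b _.
by rewrite iter_dmulD scalerDr.
Qed.

Lemma op_mul0l q : op_mul 0 q = 0.
Proof. by rewrite /op_mul size_poly0 big_ord0. Qed.

Lemma op_mulZl a p q : op_mul (a *: p) q = a *: op_mul p q.
Proof.
rewrite (@op_mul_wide (size p)) ?size_scale_leq // scaler_sumr.
by apply: eq_bigr => b _; rewrite coefZ scalerA.
Qed.

Lemma op_mulCl a q : op_mul a%:P q = a *: q.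
Proof.
by rewrite (@op_mul_wide 1) ?size_polyC ?leq_b1 // big_ord1 coefC.
Qed.

Lemma op_mulMXl p q : op_mul (p * 'X) q = op_mul p (dmul q).
Proof.
rewrite (@op_mul_wide (size p).+1); last first.
  by rewrite (leq_trans (size_polyMleq _ _)) // size_polyX addn2.
rewrite big_ord_recl coefMX eqxx scale0r add0r; apply: eq_bigr => b _.
by rewrite coefMX /= -iterSr.
Qed.

Lemma op_mulMXr p q : op_mul p (q * 'X) = op_mul p q * 'X.
Proof.
by rewrite mulr_suml; apply: eq_bigr => b _; rewrite iter_dmulMX -scalerAl.
Qed.

Lemma op_mul1r : left_id 1 op_mul.
Proof. by move=> q; rewrite op_mulCl scale1r. Qed.

Lemma op_mulr1 : right_id 1 op_mul.
Proof.
move=> p; rewrite -[RHS]coefK poly_def.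
by apply: eq_bigr => b _; rewrite iter_dmul1.
Qed.

Lemma inner_derivC a : inner_deriv a%:P = a^`()%:P.
Proof.
apply/polyP=> j; rewrite inner_derivE !coefC.
by case: eqP; rewrite ?deriv0.
Qed.

(** The associativity of the product comes down to the case where the left
    factor is v. *)
Lemma op_mul_dmul p q : op_mul (dmul p) q = dmul (op_mul p q).
Proof.
elim/poly_ind: p q => [|p a IHp] q; first by rewrite dmul0 !op_mul0l dmul0.
rewrite dmulD dmulMX !op_mulDl !op_mulMXl IHp dmulD; congr (_ + _).
by rewrite inner_derivC !op_mulCl dmulZ.
Qed.

Lemma op_mulA : associative op_mul.
Proof.
move=> p q r; elim/poly_ind: p q => [|p a IHp] q; first by rewrite !op_mul0l.
by rewrite !op_mulDl !op_mulMXl -op_mul_dmul IHp !op_mulCl op_mulZl.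
Qed.

Lemma diffop_one_neq0 : (1 : {poly {poly R}}) != 0.
Proof. exact: oner_neq0. Qed.

HB.instance Definition _ := GRing.Zmodule_isNzRing.Build W
  op_mulA op_mul1r op_mulr1 op_mulDl op_mulDr diffop_one_neq0.

(** Scaling by R, as opposed to the scaling by the coefficient ring [{poly R}]
    that [{poly {poly R}}] already has. *)
Definition op_scale (k : R) (p : W) : W := k%:P *: (p : {poly {poly R}}).

Lemma op_scaleA k l p : op_scale k (op_scale l p) = op_scale (k * l) p.
Proof. by rewrite /op_scale scalerA polyCM. Qed.

Lemma op_scale1 : left_id 1 op_scale.
Proof. by move=> p; rewrite /op_scale scale1r. Qed.

Lemma op_scaleDr : right_distributive op_scale +%R.
Proof. by move=> k p q; rewrite /op_scale scalerDr. Qed.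

Lemma op_scaleDl p : {morph op_scale^~ p : k l / k + l}.
Proof. by move=> k l; rewrite /op_scale polyCD scalerDl. Qed.

HB.instance Definition _ := GRing.Zmodule_isLmodule.Build R W
  op_scaleA op_scale1 op_scaleDr op_scaleDl.

Lemma op_scaleAl (k : R) (x y : W) : k *: (x * y) = k *: x * y.
Proof. by rewrite /GRing.scale /= /op_scale /GRing.mul /= op_mulZl. Qed.
HB.instance Definition _ := GRing.Lmodule_isLalgebra.Build R W op_scaleAl.

Lemma op_scaleAr (k : R) (x y : W) : k *: (x * y) = x * (k *: y).
Proof.
rewrite /GRing.scale /= /op_scale /GRing.mul /= /op_mul scaler_sumr.
apply: eq_bigr => b _; rewrite scalerA mulrC -scalerA.
by rewrite -iter_dmulZC.
Qed.
HB.instance Definition _ := GRing.Lalgebra_isAlgebra.Build R W op_scaleAr.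

End DiffOp.

Section DiffOpTheory.
Variable R : comNzRingType.
Local Notation W := (diffop R).
Implicit Types (p q : W) (a : {poly R}).

Definition opC a : W := a%:P.
Definition opV : W := 'X.
Definition opU : W := opC 'X.
Definition opcoef p (j : nat) : {poly R} := (p : {poly {poly R}})`_j.

Lemma diffopP p q : (forall j, opcoef p j = opcoef q j) <-> p = q.
Proof. by split=> [eq_pq|->//]; apply/polyP. Qed.

Lemma opcoefD p q j : opcoef (p + q) j = opcoef p j + opcoef q j.
Proof. exact: coefD. Qed.

Lemma opcoefB p q j : opcoef (p - q) j = opcoef p j - opcoef q j.
Proof. exact: coefB. Qed.

Lemma opcoefC a j : opcoef (opC a) j = if j == 0 then a else 0.
Proof. exact: coefC. Qed.

Lemma opcoefMn p n j : opcoef (p *+ n) j = opcoef p j *+ n.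
Proof. exact: coefMn. Qed.

Lemma opcoefZ (k : R) p j : opcoef (k *: p) j = k *: opcoef p j.
Proof. by rewrite -mul_polyC; exact: coefZ. Qed.

Lemma opcoef_Cmul a p j : opcoef (opC a * p) j = a * opcoef p j.
Proof. by rewrite /opcoef -coefZ -op_mulCl. Qed.

Lemma mulr_opVE p : p * opV = (p : {poly {poly R}}) * 'X.
Proof.
by have := op_mulMXr p 1; rewrite op_mulr1 mul1r.
Qed.

Lemma opcoef_mulV p j : opcoef (p * opV) j = if j == 0 then 0 else opcoef p j.-1.
Proof. by rewrite /opcoef mulr_opVE coefMX. Qed.

Lemma mul_opVE p : opV * p = dmul p.
Proof.
have := op_mulMXl (1 : {poly {poly R}}) p; rewrite mul1r => E; rewrite -[LHS]/(op_mul 'X p) E.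
exact: op_mul1r.
Qed.

Lemma opcoef_Vmul p j :
  opcoef (opV * p) j = (if j == 0 then 0 else opcoef p j.-1) + (opcoef p j)^`().
Proof. by rewrite /opcoef mul_opVE coefD coefMX inner_derivE. Qed.

Lemma opVXn n : opV ^+ n = 'X^n :> {poly {poly R}}.
Proof. by elim: n => // n IHn; rewrite [LHS]exprSr mulr_opVE IHn -exprSr. Qed.

Lemma opcoef_mulVn p n j :
  opcoef (p * opV ^+ n) j = if (j < n)%N then 0 else opcoef p (j - n).
Proof.
elim: n j => [|n IHn] j; first by rewrite mulr1 subn0.
rewrite exprSr mulrA opcoef_mulV; case: j => //= j; exact: IHn.
Qed.

Fact opC_additive : zmod_morphism opC.
Proof. exact: polyCB. Qed.
HB.instance Definition _ := GRing.isZmodMorphism.Build {poly R} W opC opC_additive.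

Fact opC_multiplicative : monoid_morphism opC.
Proof.
split=> // a b; apply/diffopP => j.
by rewrite opcoef_Cmul !opcoefC; case: eqP; rewrite ?mulr0.
Qed.
HB.instance Definition _ :=
  GRing.isMonoidMorphism.Build {poly R} W opC opC_multiplicative.

Fact opC_scalable : scalable opC.
Proof.
move=> k a; apply/diffopP => j.
by rewrite opcoefZ !opcoefC; case: eqP; rewrite ?scaler0.
Qed.
HB.instance Definition _ :=
  GRing.isScalable.Build R {poly R} W *:%R opC opC_scalable.

Lemma opV_commC a : opV * opC a = opC a * opV + opC a^`().
Proof.
apply/diffopP=> j; rewrite opcoefD opcoef_mulV opcoef_Vmul !opcoefC.
by case: j => [|[|j]] //=; rewrite ?opcoefC ?deriv0 ?add0r ?addr0.
Qed.

Lemma opVU : opV * opU - opU * opV = 1.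
Proof. by rewrite opV_commC derivX addrC addKr. Qed.

(** Induction on the order, peeling off powers of v on the right. *)
Lemma diffop_ind (P : W -> Prop) :
  P 0 -> (forall p a, P p -> P (p * opV + opC a)) -> forall p, P p.
Proof.
move=> P0 PS; elim/poly_ind => // p a Pp.
by rewrite -mulr_opVE; apply: PS.
Qed.

Lemma opC_horner a : opC a = horner_alg opU a.
Proof.
elim/poly_ind: a => [|a c IHa]; first by rewrite !raddf0.
rewrite [RHS]rmorphD rmorphM /= horner_algX horner_algC -IHa.
rewrite raddfD /= rmorphM /=; congr (_ + _).
by rewrite -[c%:P]alg_polyC linearZ /= rmorph1.
Qed.

Section Eval.
Variables (B : algType R) (u v : B).

Definition op_eval (p : W) : B :=
  \sum_(b < size (p : {poly {poly R}})) horner_alg u (opcoef p b) * v ^+ b.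

Lemma op_eval_wide n p : (size (p : {poly {poly R}}) <= n)%N ->
  op_eval p = \sum_(b < n) horner_alg u (opcoef p b) * v ^+ b.
Proof.
move=> le_pn; rewrite /op_eval.
rewrite (big_ord_widen n (fun b => horner_alg u (opcoef p b) * v ^+ b)) //.
rewrite big_mkcond; apply: eq_bigr => b _; case: ltnP => // le_pb.
by rewrite /opcoef nth_default // rmorph0 mul0r.
Qed.

Fact op_eval_linear : linear op_eval.
Proof.
move=> k p q; set n := maxn (size (p : {poly {poly R}})) (size (q : {poly {poly R}})).
have le_n : (size (k *: p + q : {poly {poly R}})%R <= n)%N.
  apply: leq_trans (size_polyD _ _) _; rewrite geq_max /n leq_max leq_maxr andbT.
  by rewrite (leq_trans (size_scale_leq _ _)).
rewrite !(@op_eval_wide n) ?leq_maxl ?leq_maxr // scaler_sumr -big_split /=.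
by apply: eq_bigr => b _; rewrite opcoefD opcoefZ linearP /= mulrDl mulr_algl -scalerAl.
Qed.
HB.instance Definition _ :=
  GRing.isLinear.Build R W B *:%R op_eval op_eval_linear.

Lemma op_evalC a : op_eval (opC a) = horner_alg u a.
Proof.
rewrite (@op_eval_wide 1) ?big_ord1 ?mulr1 ?opcoefC //.
by rewrite size_polyC leq_b1.
Qed.

Lemma op_eval_mulV p : op_eval (p * opV) = op_eval p * v.
Proof.
rewrite (@op_eval_wide (size (p : {poly {poly R}})).+1); last first.
  by rewrite mulr_opVE (leq_trans (size_polyMleq _ _)) // size_polyX addn2.
rewrite big_ord_recl opcoef_mulV rmorph0 mul0r add0r mulr_suml.
by apply: eq_bigr => b _; rewrite opcoef_mulV /= -mulrA -exprSr.
Qed.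

Lemma op_evalV : op_eval opV = v.
Proof. by rewrite -[opV]mul1r op_eval_mulV -(rmorph1 opC) op_evalC rmorph1 mul1r. Qed.

Lemma op_evalU : op_eval opU = u.
Proof. by rewrite op_evalC horner_algX. Qed.

Hypothesis vu : v * u - u * v = 1.

(** The commutator with v acts on polynomials in u as the derivation. *)
Lemma horner_alg_commutator a :
  v * horner_alg u a = horner_alg u a * v + horner_alg u a^`().
Proof.
elim/poly_ind: a => [|a c IHa]; first by rewrite deriv0 rmorph0 mulr0 mul0r addr0.
rewrite derivD derivM derivX derivC addr0 mulr1 !rmorphD !rmorphM /= horner_algX horner_algC.
rewrite mulrDr mulrA IHa !mulrDl -!mulrA.
have -> : v * u = u * v + 1 by rewrite -vu addrC addrNK.
rewrite mulrDr mulr1 mulr_algr mulr_algl -!addrA; congr (_ + _).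
by rewrite [RHS]addrC -addrA addrCA.
Qed.

Lemma op_eval_mul_opV q : op_eval (opV * q) = v * op_eval q.
Proof.
elim/diffop_ind: q => [|q a IHq]; first by rewrite mulr0 raddf0 mulr0.
rewrite mulrDr !raddfD /= mulrA !op_eval_mulV IHq mulrDr mulrA; congr (_ + _).
by rewrite opV_commC raddfD /= op_eval_mulV !op_evalC horner_alg_commutator.
Qed.

Lemma op_eval_mulC a q : op_eval (opC a * q) = horner_alg u a * op_eval q.
Proof.
elim/diffop_ind: q => [|q b IHq]; first by rewrite mulr0 raddf0 mulr0.
rewrite mulrDr !raddfD /= mulrA !op_eval_mulV IHq mulrDr mulrA.
by rewrite -rmorphM !op_evalC rmorphM.
Qed.

Fact op_eval_multiplicative : monoid_morphism op_eval.
Proof.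
split=> [|p q]; first by rewrite -(rmorph1 opC) op_evalC rmorph1.
elim/diffop_ind: p q => [|p a IHp] q; first by rewrite mul0r raddf0 mul0r.
rewrite mulrDl !raddfD /= -mulrA IHp op_eval_mul_opV op_eval_mulC op_eval_mulV.
by rewrite op_evalC mulrDl mulrA.
Qed.

End Eval.

End DiffOpTheory.

Section EvalMorph.
Variables (R : comNzRingType) (B : algType R) (u v : B).
Hypothesis vu : v * u - u * v = 1.

(** The relation is an argument so that the morphism structure can be inferred
    from the term. *)
Definition op_eval_morph of (v * u - u * v = 1) : diffop R -> B := op_eval u v.
HB.instance Definition _ := GRing.Linear.on (op_eval_morph vu).
HB.instance Definition _ := GRing.isMonoidMorphism.Build (diffop R) B
  (op_eval_morph vu) (op_eval_multiplicative vu).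

End EvalMorph.

Section Adjoint.
Variable R : comNzRingType.
Local Notation W := (diffop R).

Lemma adjoint_relation :
  (- opV R : W^c) * (opU R : W^c) - (opU R : W^c) * (- opV R : W^c) = 1.
Proof.
rewrite -[LHS]/(opU R * - opV R - (- opV R) * opU R).
by rewrite mulrN mulNr opprK addrC opVU.
Qed.

(** The formal adjoint, as the morphism to the converse ring that fixes u and
    negates v. *)
Definition op_adj (p : W) : W := @op_eval R W^c (opU R) (- opV R) p.

Lemma op_adjU : op_adj (opU R) = opU R.
Proof. exact: (@op_evalU R W^c). Qed.

Lemma op_adjV : op_adj (opV R) = - opV R.
Proof. exact: (@op_evalV R W^c). Qed.

Lemma op_adjM p q : op_adj (p * q) = op_adj q * op_adj p.
Proof.
exact: (rmorphM (@op_eval_morph R W^c (opU R) (- opV R) adjoint_relation)).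
Qed.

Lemma op_adj1 : op_adj 1 = 1.
Proof.
exact: (rmorph1 (@op_eval_morph R W^c (opU R) (- opV R) adjoint_relation)).
Qed.

Lemma op_adjX n p : op_adj (p ^+ n) = op_adj p ^+ n.
Proof. by elim: n => [|n IHn]; rewrite ?op_adj1 // exprS op_adjM IHn -exprSr. Qed.

Lemma op_adjD p q : op_adj (p + q) = op_adj p + op_adj q.
Proof. exact: (raddfD (@op_eval R W^c (opU R) (- opV R))). Qed.

Lemma op_adj0 : op_adj 0 = 0.
Proof. exact: (raddf0 (@op_eval R W^c (opU R) (- opV R))). Qed.

Lemma op_adjC a : op_adj (opC a) = opC a.
Proof.
rewrite /op_adj op_evalC opC_horner; elim/poly_ind: a => [|a c IHa].
  by rewrite !rmorph0.
rewrite !(rmorphD, rmorphM) /= IHa !horner_algX !horner_algC; congr (_ + _).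
by rewrite -opC_horner -[LHS]/(opU R * opC a) /opU -!rmorphM mulrC.
Qed.

End Adjoint.

Section BaseChange.
Variables (A R : comNzRingType) (f : {rmorphism A -> R}).

Definition map_op (p : diffop A) : diffop R := map_poly (map_poly f) p.

Lemma opcoef_map p j : opcoef (map_op p) j = map_poly f (opcoef p j).
Proof. exact: coef_map. Qed.

Fact map_op_additive : zmod_morphism map_op.
Proof. by move=> p q; apply/diffopP => j; rewrite opcoefB !opcoef_map opcoefB rmorphB. Qed.
HB.instance Definition _ :=
  GRing.isZmodMorphism.Build (diffop A) (diffop R) map_op map_op_additive.

Lemma map_opC a : map_op (opC a) = opC (map_poly f a).
Proof. by apply/diffopP => j; rewrite opcoef_map !opcoefC; case: eqP; rewrite ?rmorph0. Qed.

Lemma map_op_mulV p : map_op (p * opV A) = map_op p * opV R.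
Proof.
apply/diffopP => j; rewrite opcoef_map !opcoef_mulV.
by case: eqP; rewrite ?rmorph0 ?opcoef_map.
Qed.

Lemma map_op_Vmul p : map_op (opV A * p) = opV R * map_op p.
Proof.
apply/diffopP => j; rewrite opcoef_map !opcoef_Vmul rmorphD !opcoef_map deriv_map.
by case: eqP; rewrite ?rmorph0.
Qed.

Lemma map_op_Cmul a p : map_op (opC a * p) = opC (map_poly f a) * map_op p.
Proof.
by apply/diffopP => j; rewrite opcoef_map !opcoef_Cmul rmorphM opcoef_map.
Qed.

Fact map_op_multiplicative : monoid_morphism map_op.
Proof.
split=> [|p q]; first by rewrite -(rmorph1 (@opC A)) map_opC !rmorph1.
elim/diffop_ind: p q => [|p a IHp] q; first by rewrite mul0r raddf0 mul0r.
rewrite mulrDl !raddfD /= -mulrA IHp map_op_Vmul map_op_Cmul map_op_mulV map_opC.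
by rewrite mulrDl mulrA.
Qed.
HB.instance Definition _ :=
  GRing.isMonoidMorphism.Build (diffop A) (diffop R) map_op map_op_multiplicative.

Lemma map_opV : map_op (opV A) = opV R.
Proof. by rewrite -[opV A]mul1r map_op_mulV rmorph1 mul1r. Qed.

Lemma map_opU : map_op (opU A) = opU R.
Proof. by rewrite map_opC map_polyX. Qed.

Lemma map_op_adj p : map_op (op_adj p) = op_adj (map_op p).
Proof.
elim/diffop_ind: p => [|p a IHp]; first by rewrite op_adj0 rmorph0 op_adj0.
rewrite op_adjD op_adjM op_adjV op_adjC rmorphD rmorphM rmorphN /= IHp.
by rewrite map_opV rmorphD rmorphM /= map_opV op_adjD op_adjM op_adjV !map_opC op_adjC.
Qed.

Lemma map_op_inj : injective f -> injective map_op.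
Proof.
move=> f_inj p q /diffopP eq_pq; apply/diffopP=> j; have := eq_pq j.
by rewrite !opcoef_map => /(map_inj_poly f_inj (rmorph0 f)).
Qed.

End BaseChange.

(** * Powers of a Weyl pair of matrices in characteristic p *)

Section Commutators.
Variables (B : nzRingType) (x y : B).
Hypothesis yx : y * x - x * y = 1.

Lemma comm_expl n : y ^+ n * x = x * y ^+ n + y ^+ n.-1 *+ n.
Proof.
have yxE : y * x = x * y + 1 by rewrite -yx addrC addrNK.
elim: n => [|n IHn]; first by rewrite mul1r mulr1 addr0.
rewrite exprS -mulrA IHn mulrDr mulrA yxE mulrDl mul1r -mulrA -exprS -addrA.
congr (_ + _); rewrite -[X in X + _]mulr1n mulrnAr.
by case: n {IHn} => [|n]; rewrite ?mulr0n ?addr0 // -exprS -mulrnDr.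
Qed.

Lemma comm_expr n : y * x ^+ n = x ^+ n * y + x ^+ n.-1 *+ n.
Proof.
have yxE : y * x = x * y + 1 by rewrite -yx addrC addrNK.
elim: n => [|n IHn]; first by rewrite mul1r mulr1 addr0.
rewrite exprSr mulrA IHn mulrDl -mulrA yxE mulrDr mulr1 mulrA -exprSr -addrA.
congr (_ + _); rewrite -[X in X + _]mulr1n mulrnAl.
by case: n {IHn} => [|n]; rewrite ?mulr0n ?addr0 // -exprSr -mulrnDr.
Qed.
End Commutators.

Lemma pchar_coprime_mulrn (R : nzRingType) (V : lmodType R) (p i : nat) (x : V) :
  p \in [pchar R] -> coprime i p -> x *+ i = 0 -> x = 0.
Proof.
move=> pR co_ip xi0; have p0 : p%:R = 0 :> R by apply: pcharf0.
have xp0 : x *+ p = 0 by rewrite -scaler_nat p0 scale0r.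
have p_gt0 : (0 < p)%N by apply/prime_gt0/pcharf_prime/pR.
case: (posnP i) co_ip => [-> | i_gt0 co_ip].
  by rewrite /coprime gcd0n => /eqP p1; rewrite p1 mulr1n in xp0.
have [m n e _] := egcdnP p i_gt0.
move: co_ip => /eqP gcd1; rewrite gcd1 in e.
have mi0 : x *+ (m * i) = 0 by rewrite mulnC [LHS]mulrnA xi0 mul0rn.
have np0 : x *+ (n * p) = 0 by rewrite mulnC [LHS]mulrnA xp0 mul0rn.
by rewrite e mulrnDr np0 add0r in mi0.
Qed.

(** Bracketing a relation f(D) = 0 with S gives f'(D) = 0.  Nonconstant
    polynomials of degree less than p have a nonzero derivative, so by descent
    there is no nonzero relation of degree less than p, and a monic relation of
    degree p has derivative zero. *)
Section Annihilator.
Variables (C : comNzRingType) (B : algType C) (D S : B) (p : nat).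
Hypothesis DS : D * S - S * D = 1.
Hypothesis pC : p \in [pchar C].
Hypothesis algC_inj : forall c : C, c%:A = 0 :> B -> c = 0.

Lemma annihilator_deriv f : horner_alg D f = 0 -> horner_alg D f^`() = 0.
Proof.
move=> fD; have SD : (- S) * D - D * (- S) = 1 by rewrite mulNr mulrN opprK addrC.
by have := horner_alg_commutator SD f; rewrite fD mulr0 mul0r add0r => /esym.
Qed.

Lemma deriv_eq0_coef (f : {poly C}) i :
  f^`() = 0 -> (0 < i)%N -> coprime i p -> f`_i = 0.
Proof.
case: i => // i f'0 _ co_ip.
have := congr1 (fun g : {poly C} => g`_i) f'0; rewrite coef_deriv coef0 => fi0.
exact: (@pchar_coprime_mulrn C C^o p i.+1).
Qed.

Lemma annihilator_eq0 (f : {poly C}) : (size f <= p)%N -> horner_alg D f = 0 -> f = 0.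
Proof.
have p_pr : prime p := pcharf_prime pC.
move: {2}(size f) (leqnn (size f)) => n; elim: n f => [|n IHn] f le_fn le_fp fD.
  by apply/eqP; rewrite -size_poly_leq0.
have [-> // | f_n0] := eqVneq f 0.
have f'0 : f^`() = 0.
  have lt_f' := lt_size_deriv f_n0.
  apply: IHn (annihilator_deriv fD); first by rewrite -ltnS (leq_trans lt_f').
  by rewrite (leq_trans (ltnW lt_f')).
suff fE : f = (f`_0)%:P.
  by move: fD; rewrite fE horner_algC => /algC_inj ->; rewrite polyC0.
apply/polyP=> -[|i]; rewrite coefC //=.
have [le_fi | lt_if] := leqP (size f) i.+1; first by rewrite nth_default.
apply: deriv_eq0_coef => //; rewrite coprime_sym prime_coprime //.
by rewrite gtnNdvd // (leq_trans lt_if).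
Qed.

Lemma monic_annihilator (f : {poly C}) :
  f \is monic -> size f = p.+1 -> horner_alg D f = 0 ->
  D ^+ p = (- f`_0)%:A.
Proof.
move=> f_mon sz_f fD; have p_pr : prime p := pcharf_prime pC.
have f'0 : f^`() = 0.
  apply: annihilator_eq0 (annihilator_deriv fD).
  by rewrite -ltnS -sz_f lt_size_deriv // -size_poly_gt0 sz_f.
suff fE : f = 'X^p + (f`_0)%:P.
  move: fD; rewrite {1}fE rmorphD rmorphXn /= horner_algX horner_algC.
  by move/eqP; rewrite addr_eq0 scaleNr => /eqP.
apply/polyP=> i; rewrite coefD coefXn coefC.
case: (ltngtP i p) => [lt_ip|gt_ip|->]; first last.
- rewrite -(prednK (prime_gt0 p_pr)) addr0.
  by rewrite prednK ?prime_gt0 //; move/monicP: f_mon; rewrite lead_coefE sz_f.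
- rewrite add0r ifN ?nth_default ?sz_f //; by case: i gt_ip.
case: i lt_ip => [|i] lt_ip; first by rewrite add0r.
rewrite addr0; apply: deriv_eq0_coef => //.
by rewrite coprime_sym prime_coprime // gtnNdvd.
Qed.
End Annihilator.

Lemma horner_mx_algE (C : comNzRingType) n (M : 'M[C]_n.+1) (f : {poly C}) :
  horner_mx M f = horner_alg M f.
Proof.
elim/poly_ind: f => [|f c IHf]; first by rewrite !rmorph0.
rewrite !(rmorphD, rmorphM) /= IHf horner_mx_X horner_mx_C horner_algX horner_algC.
by rewrite scalemx1.
Qed.

Lemma matrix_weyl_pow (C : comNzRingType) n (D S : 'M[C]_n.+1) :
  n.+1 \in [pchar C] -> D * S - S * D = 1 -> exists c, D ^+ n.+1 = c%:M.
Proof.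
move=> pC DS; exists (- (char_poly D)`_0); rewrite -scalemx1.
have chi0 : horner_alg D (char_poly D) = 0.
  by rewrite -horner_mx_algE Cayley_Hamilton.
have sz := size_char_poly D; have mon := char_poly_monic D.
apply: (monic_annihilator DS pC _ mon sz chi0).
move=> c /(congr1 (fun M : 'M[C]_n.+1 => M 0 0)).
by rewrite !mxE eqxx mulr1.
Qed.

(** * Central elements in characteristic p *)

Section Centre.
Variables (R : comNzRingType) (n : nat).
Local Notation p := n.+1.
Hypothesis pR : p \in [pchar R].
Local Notation W := (diffop R).
Local Notation C := {poly {poly R}}.
Implicit Types (x y : W) (a : {poly R}).

Lemma pcharW : p \in [pchar W].
Proof.
rewrite inE (pcharf_prime pR) /=; apply/eqP/diffopP=> j.
rewrite opcoefMn -(rmorph1 (@opC R)) opcoefC /opcoef coef0.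
by case: eqP => _; rewrite ?mul0rn // -polyC1 -rmorphMn /= pcharf0 // polyC0.
Qed.

Lemma comm_opVp x : opV R ^+ p * x = x * opV R ^+ p.
Proof.
have VpU : opV R ^+ p * opU R = opU R * opV R ^+ p.
  rewrite (comm_expl (opVU R)) -mulr_natr pcharf0 ?mulr0 ?addr0 //.
  exact: pcharW.
elim/diffop_ind: x => [|x a IHx]; first by rewrite mul0r mulr0.
rewrite mulrDr mulrDl mulrA IHx -!mulrA -exprS -exprSr; congr (_ + _).
elim/poly_ind: a => [|a c IHa]; first by rewrite !rmorph0 mul0r mulr0.
rewrite rmorphD rmorphM /= mulrDr mulrDl mulrA IHa -!mulrA VpU; congr (_ + _).
by rewrite -[c%:P]alg_polyC linearZ /= rmorph1 -scalerAl -scalerAr mul1r mulr1.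
Qed.

Lemma comm_opUp x : opU R ^+ p * x = x * opU R ^+ p.
Proof.
have VUp : opV R * opU R ^+ p = opU R ^+ p * opV R.
  rewrite (comm_expr (opVU R)) -mulr_natr pcharf0 ?mulr0 ?addr0 //.
  exact: pcharW.
elim/diffop_ind: x => [|x a IHx]; first by rewrite mul0r mulr0.
rewrite mulrDr mulrDl mulrA IHx -!mulrA VUp; congr (_ + _).
by rewrite /opU -rmorphXn -!rmorphM mulrC.
Qed.

(** In characteristic p the power v^p is central, so the operators form a free
    left module over the commutative ring R[u][v^p], with basis the powers v^j,
    j < p; this is the coordinate of index j, with v^p as the outer variable. *)
Definition residue_part (j : nat) (x : W) : C :=
  \poly_(q < size (x : C)) opcoef x (q * p + j).

Lemma coef_residue_part j x q : (residue_part j x)`_q = opcoef x (q * p + j).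
Proof.
rewrite coef_poly; case: ltnP => // le_xq; rewrite /opcoef nth_default //.
by rewrite (leq_trans le_xq) // (leq_trans _ (leq_addr _ _)) // leq_pmulr.
Qed.

Lemma residue_partD j x y :
  residue_part j (x + y) = residue_part j x + residue_part j y.
Proof. by apply/polyP=> q; rewrite coefD !coef_residue_part opcoefD. Qed.

Lemma residue_part0 j : residue_part j 0 = 0.
Proof. by apply/polyP=> q; rewrite coef_residue_part coef0 /opcoef coef0. Qed.

Lemma residue_partC j a x : residue_part j (opC a * x) = a%:P * residue_part j x.
Proof.
by apply/polyP=> q; rewrite coefCM !coef_residue_part opcoef_Cmul.
Qed.

Lemma residue_part_Vp j x : (j < p)%N ->
  residue_part j (opV R ^+ p * x) = residue_part j x * 'X.
Proof.
move=> lt_jp; apply/polyP=> q; rewrite comm_opVp coefMX !coef_residue_part.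
rewrite opcoef_mulVn; case: q => [|q] /=; first by rewrite mul0n lt_jp.
by rewrite mulSn -addnA ltnNge leq_addr /= addKn.
Qed.

Lemma residue_part_V i j : (i < p)%N -> (j < p)%N ->
  residue_part j (opV R ^+ i) = (i == j)%:R.
Proof.
move=> lt_ip lt_jp; apply/polyP=> q.
rewrite coef_residue_part /opcoef opVXn coefXn.
have [-> | ne_ij] := eqVneq i j.
  by rewrite coef1; case: q => [|q]; rewrite ?eqxx // gtn_eqF // mulSn -addnA ltn_addr.
rewrite coef0; case: q => [|q]; first by rewrite mul0n add0n eq_sym (negbTE ne_ij).
by rewrite gtn_eqF // mulSn -addnA ltn_addr.
Qed.

Lemma residue_partM j x y : (j < p)%N ->
  residue_part j (x * y) =
    \sum_(l < p) residue_part l x * residue_part j (opV R ^+ l * y).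
Proof.
move=> lt_jp; elim/diffop_ind: x y => [|x a IHx] y.
  by rewrite mul0r residue_part0 big1 // => l _; rewrite residue_part0 mul0r.
rewrite mulrDl residue_partD -mulrA IHx residue_partC.
under [RHS]eq_bigr => l _ do rewrite residue_partD mulrDl.
rewrite big_split /=; congr (_ + _).
  rewrite big_ord_recr [RHS]big_ord_recl addrC /= mulrA -exprSr residue_part_Vp //.
  congr (_ + _); last first.
    rewrite expr0 mul1r mulrA mulrAC; congr (_ * _); apply/polyP=> -[|q].
      by rewrite coefMX /= coef_residue_part opcoef_mulV mul0n.
    rewrite coefMX /= !coef_residue_part opcoef_mulV addn0 mulSn /=.
    by rewrite [(n + _)%N]addnC.
  apply: eq_bigr => l _; rewrite mulrA -exprSr /bump /= add1n; congr (_ * _).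
  apply/polyP=> q; rewrite !coef_residue_part opcoef_mulV addnS /=; done.
rewrite big_ord_recl big1 => [|l _].
  rewrite addr0 expr0 mul1r; congr (_ * _); apply/polyP=> q.
  by rewrite coefC coef_residue_part opcoefC addn0 muln_eq0 orbF.
suff -> : residue_part (lift ord0 l) (opC a) = 0 by rewrite mul0r.
by apply/polyP=> q; rewrite coef_residue_part opcoefC coef0 addnS.
Qed.

(** Right multiplication by x in the basis of the powers of v; it acts on row
    vectors, so it is a morphism and not an anti-morphism. *)
Definition regular_mx x : 'M[C]_p := \matrix_(i, j) residue_part j (opV R ^+ i * x).

Lemma regular_mxM x y : regular_mx (x * y) = regular_mx x * regular_mx y.
Proof.
apply/matrixP=> i j; rewrite !mxE mulrA residue_partM //.
by apply: eq_bigr => l _; rewrite !mxE.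
Qed.

Lemma regular_mxD x y : regular_mx (x + y) = regular_mx x + regular_mx y.
Proof. by apply/matrixP=> i j; rewrite !mxE mulrDr residue_partD. Qed.

Lemma regular_mx1 : regular_mx 1 = 1.
Proof. by apply/matrixP=> i j; rewrite !mxE mulr1 residue_part_V. Qed.

Fact regular_mx_additive : zmod_morphism regular_mx.
Proof.
by move=> x y; apply: (addIr (regular_mx y)); rewrite -regular_mxD !addrNK.
Qed.
HB.instance Definition _ :=
  GRing.isZmodMorphism.Build W 'M[C]_p regular_mx regular_mx_additive.
HB.instance Definition _ :=
  GRing.isMonoidMorphism.Build W 'M[C]_p regular_mx
    (regular_mx1, regular_mxM).

Lemma regular_mx_inj : injective regular_mx.
Proof.
move=> x y /matrixP eq_xy; apply/diffopP=> m.
have lt_m : (m %% p < p)%N by rewrite ltn_mod.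
have := congr1 (fun P : C => P`_(m %/ p)) (eq_xy 0 (Ordinal lt_m)).
by rewrite !mxE !expr0 !mul1r !coef_residue_part /= -divn_eq.
Qed.

(** The matrix of D^p is scalar, and the regular representation is faithful. *)
Lemma weyl_pow_central (S D x : W) : D * S - S * D = 1 -> D ^+ p * x = x * D ^+ p.
Proof.
move=> DS; apply: regular_mx_inj; rewrite !rmorphM rmorphXn /=.
have [] := @matrix_weyl_pow C n (regular_mx D) (regular_mx S).
- by rewrite inE (pcharf_prime pR) /= -!polyC1 -!rmorphMn /= (pcharf0 pR) !polyC0.
- by rewrite -!rmorphM -rmorphB DS rmorph1.
by move=> c ->; exact: (esym (scalar_mxC _ _)).
Qed.

End Centre.

Section CentreEmbedding.
Variables (R : comNzRingType) (n : nat).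
Local Notation p := n.+1.
Hypothesis pR : p \in [pchar R].
Local Notation W := (diffop R).
Local Notation C := {poly {poly R}}.
Implicit Types (x y : W) (a : {poly R}) (P Q : C).

Definition opC_Xp : {poly R} -> W := @opC R \o comp_poly 'X^p.
HB.instance Definition _ := GRing.RMorphism.on opC_Xp.

Lemma comm_opVp_Xp : commr_rmorph opC_Xp (opV R ^+ p).
Proof. by move=> a; apply: comm_opVp. Qed.

(** The embedding of R[U, V] that sends U to u^p and V to v^p. *)
Definition centre_embed : C -> W := horner_morph comm_opVp_Xp.
HB.instance Definition _ := GRing.RMorphism.on centre_embed.

Lemma centre_embedC a : centre_embed a%:P = opC (a \Po 'X^p).
Proof. exact: horner_morphC. Qed.

Lemma centre_embedX : centre_embed 'X = opV R ^+ p.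
Proof. exact: horner_morphX. Qed.

Lemma centre_embedN P : centre_embed (- P) = - centre_embed P.
Proof. by apply/eqP; rewrite -addr_eq0 -rmorphD addNr rmorph0. Qed.

Lemma opcoef_centre P m :
  opcoef (centre_embed P) m = if (p %| m)%N then P`_(m %/ p) \Po 'X^p else 0.
Proof.
elim/poly_ind: P m => [|P a IHP] m.
  by rewrite rmorph0 coef0 comp_poly0 if_same /opcoef coef0.
rewrite rmorphD rmorphM /= centre_embedC centre_embedX opcoefD opcoef_mulVn opcoefC.
rewrite coefD coefMX coefC comp_polyD IHP.
have [lt_mp | le_pm] := ltnP m p.
  rewrite add0r divn_small //=; case: m lt_mp => [|m] lt_mp.
    by rewrite dvdn0 comp_poly0 add0r.
  by rewrite gtnNdvd.
have m_n0 : m == 0 = false by case: m le_pm.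
have -> : (p %| m - p)%N = (p %| m)%N by rewrite dvdn_subl ?dvdnn.
have -> : (m %/ p = ((m - p) %/ p).+1)%N.
  by rewrite -{1}(subnK le_pm) divnDr ?dvdnn // divnn addn1.
by rewrite m_n0 comp_poly0 !addr0.
Qed.

Lemma coef_centre P m i :
  (opcoef (centre_embed P) m)`_i =
    if (p %| m)%N && (p %| i)%N then P`_(m %/ p)`_(i %/ p) else 0.
Proof.
rewrite opcoef_centre; case: ifP => _; last by rewrite coef0.
by rewrite coef_comp_poly_Xn.
Qed.

Lemma centre_embed_inj : injective centre_embed.
Proof.
move=> P Q /diffopP eqPQ; apply/polyP=> j; apply/polyP=> i.
have := congr1 (fun a : {poly R} => a`_(i * p)) (eqPQ (j * p)%N).
by rewrite !coef_centre !dvdn_mull //= !mulnK.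
Qed.

Lemma opcoef_mulU x j :
  opcoef (x * opU R) j = 'X * opcoef x j + opcoef x j.+1 *+ j.+1.
Proof.
elim/diffop_ind: x j => [|x a IHx] j.
  by rewrite mul0r /opcoef !coef0 mulr0 mul0rn addr0.
have VU : opV R * opU R = opU R * opV R + 1 by rewrite -(opVU R) addrC addrNK.
rewrite mulrDl -mulrA VU mulrDr mulr1 mulrA !opcoefD !opcoef_mulV !opcoefC /=.
rewrite addr0 opcoef_Cmul opcoefC; case: j => [|j] /=.
  by rewrite add0r mulrDr mulr0 add0r mulrC addrC.
by rewrite !mulr0 mulrDr mulr0 !addr0 IHx -addrA -mulrSr.
Qed.

Lemma deriv0_comp_Xp a : a^`() = 0 -> exists b, a = b \Po 'X^p.
Proof.
move=> a'0; exists (\poly_(i < size a) a`_(i * p)); apply/polyP=> i.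
rewrite coef_comp_poly_Xn //; case: ifPn => [p_i | p'i].
  rewrite coef_poly divnK //; case: ltnP => // le_ai.
  by rewrite nth_default // (leq_trans le_ai) // leq_div.
apply: (deriv_eq0_coef pR) => //; first by case: i p'i => //; rewrite dvdn0.
by rewrite coprime_sym prime_coprime // (pcharf_prime pR).
Qed.

(** Commuting with v kills the derivatives of the coefficients, and commuting
    with u kills the multiples j x_j: only exponents divisible by p are left. *)
Lemma centralP x : x * opU R = opU R * x -> opV R * x = x * opV R ->
  exists P, x = centre_embed P.
Proof.
move=> xU Vx.
have x_0 m : ~~ (p %| m)%N -> opcoef x m = 0.
  case: m => [|m] p'm; first by rewrite dvdn0 in p'm.
  have /diffopP/(_ m) := xU; rewrite opcoef_mulU opcoef_Cmul.
  move/(canRL (addKr _)); rewrite addNr.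
  apply: (@pchar_coprime_mulrn R _ p) => //.
  by rewrite coprime_sym prime_coprime // (pcharf_prime pR).
have x'0 j : (opcoef x j)^`() = 0.
  have /diffopP/(_ j) := Vx; rewrite opcoef_Vmul opcoef_mulV.
  by move/(canRL (addKr _)); rewrite addNr.
have [b xE] := choice (fun j => deriv0_comp_Xp (x'0 j)).
exists (\poly_(q < size (x : C)) b (q * p)%N); apply/diffopP => m.
rewrite opcoef_centre; case: ifPn => [p_m | /x_0 //].
rewrite coef_poly; case: ltnP => [_|le_xm]; first by rewrite divnK.
rewrite comp_poly0 /opcoef nth_default //.
by rewrite (leq_trans le_xm) // leq_div.
Qed.

Lemma centre_embed_central P x : centre_embed P * x = x * centre_embed P.
Proof.
elim/poly_ind: P x => [|P a IHP] x; first by rewrite rmorph0 mul0r mulr0.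
rewrite rmorphD rmorphM /= centre_embedC centre_embedX mulrDl mulrDr.
rewrite -mulrA (comm_opVp pR) mulrA IHP -mulrA; congr (_ + _).
elim/poly_ind: a => [|a c IHa]; first by rewrite !rmorph0 mul0r mulr0.
rewrite comp_polyD comp_polyM comp_polyX comp_polyC rmorphD rmorphM rmorphXn /=.
rewrite mulrDl mulrDr -mulrA -/(opU R) (comm_opUp pR) mulrA IHa -mulrA; congr (_ + _).
by rewrite -[c%:P]alg_polyC linearZ /= rmorph1 -scalerAl -scalerAr mul1r mulr1.
Qed.

End CentreEmbedding.

(** * The Poisson bracket on the centre *)

Lemma comm_pow_pow (B : nzRingType) (x y : B) m n : y * x - x * y = 1 ->
  y ^+ n * x ^+ m =
    \sum_(i < n.+1) (x ^+ (m - i) * y ^+ (n - i)) *+ ('C(n, i) * m ^_ i).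
Proof.
move=> yx; elim: n => [|n IHn].
  by rewrite big_ord1 mul1r subn0 mulr1 ffactn0 bin0.
rewrite exprS -mulrA IHn mulr_sumr.
pose F i := x ^+ (m - i) * y ^+ (n.+1 - i).
have step (i : 'I_n.+1) : y * ((x ^+ (m - i) * y ^+ (n - i)) *+ ('C(n, i) * m ^_ i))
    = F i *+ ('C(n, i) * m ^_ i) + F i.+1 *+ ('C(n, i) * m ^_ i.+1).
  rewrite mulrnAr mulrA (comm_expr yx) mulrDl mulrnDl -mulrA -exprS.
  rewrite -subSn -1?ltnS // -/(F i); congr (_ + _).
  by rewrite mulrnAl -mulrnA -subnS /F subSS ffactnSr; congr (_ *+ _); rewrite mulnC mulnA.
under eq_bigr => i _ do rewrite step.
rewrite big_split /= [X in X + _]big_ord_recl [X in _ + X]big_ord_recr /=.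
rewrite [RHS]big_ord_recl [X in _ = _ + X]big_ord_recr /=.
rewrite !bin0 -!addrA; congr (_ + _); rewrite !binn addrA; congr (_ + _).
rewrite -big_split /=; apply: eq_bigr => i _.
by rewrite /bump /= !add1n -mulrnDr -mulnDl -binS.
Qed.

(** In the sum for y^p x^p the intermediate terms carry the two factors C(p, i)
    and p (p - 1) ... (p - i + 1), both divisible by p. *)
Lemma comm_pow_prime (B : nzRingType) (x y : B) p : prime p -> y * x - x * y = 1 ->
  exists E, y ^+ p * x ^+ p - x ^+ p * y ^+ p = ((p.-1)`!%:R + E *+ p) *+ p.
Proof.
move=> p_pr yx; have p_gt0 := prime_gt0 p_pr.
have mid i : (0 < i < p)%N -> exists k, ('C(p, i) * p ^_ i = k * (p * p))%N.
  move=> lt_ip; have [_ lt_i] := andP lt_ip.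
  have p_bin := prime_dvd_bin p_pr lt_ip.
  have p_ff : (p %| p ^_ i)%N by rewrite -bin_ffact dvdn_mulr.
  have := dvdn_mul p_bin p_ff => /dvdnP[k ->]; by exists k.
rewrite (comm_pow_pow p p yx) big_ord_recl subn0 ffactn0 bin0 mulr1n addrAC subrr add0r.
case: p p_pr p_gt0 mid => // n p_pr _ mid.
have /choice[k kE] : forall i : 'I_n, exists k,
    ('C(n.+1, i.+1) * n.+1 ^_ i.+1 = k * (n.+1 * n.+1))%N.
  by move=> i; apply: mid; rewrite /= ltnS ltn_ord.
rewrite big_ord_recr /= /bump /= add1n binn ffactnn mul1n !subnn mul1r.
exists (\sum_(i < n) (x ^+ (n.+1 - i.+1) * y ^+ (n.+1 - i.+1)) *+ k i).
rewrite addrC mulrnDl -mulrnA; congr (_ + _).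
  by rewrite mulnC -factS.
rewrite -mulrnA -sumrMnl; apply: eq_bigr => i _.
by rewrite -[in RHS]mulrnA -kE add1n.
Qed.

Section HamiltonianDerivation.
Variables (B B' : nzRingType) (f : {rmorphism B -> B'}) (p : nat).
Hypothesis f_surj : forall y, exists x, f x = y.
Hypothesis f_ker : forall x, f x = 0 -> exists y, x = y *+ p.
Hypothesis p_tf : forall x : B, x *+ p = 0 -> x = 0.
Hypothesis p_B' : forall y : B', y *+ p = 0.

(** If w is central modulo p, then [x, w] is divisible by p, and the quotient
    modulo p depends only on x modulo p: this is the Hamiltonian derivation of
    the reduction of w. *)
Lemma hamiltonian_derivation w : (forall x, f (x * w) = f (w * x)) ->
  exists d : B' -> B',
    [/\ {morph d : x y / x + y}, forall x y, d (x * y) = d x * y + x * d y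
      & forall x z, x * w - w * x = z *+ p -> d (f x) = f z].
Proof.
move=> w_central; have [s sK] := choice f_surj.
have brw x : exists z, x * w - w * x = z *+ p.
  by apply: f_ker; rewrite rmorphB /= w_central subrr.
have [br brE] := choice brw.
pose d y := f (br (s y)).
(* Two lifts of an element differ by p t, and [t, w] is again divisible by p. *)
have dE x z : x * w - w * x = z *+ p -> d (f x) = f z.
  move=> xz; have [t xt] : exists t, x - s (f x) = t *+ p.
    by apply: f_ker; rewrite rmorphB /= sK subrr.
  have zE : z = br (s (f x)) + br t *+ p.
    apply/eqP; rewrite -subr_eq0; apply/eqP/p_tf.
    apply/eqP; rewrite mulrnBl subr_eq0 mulrnDl -!brE -xz.
    have -> : x = s (f x) + t *+ p by rewrite -xt addrC addrNK.
    rewrite [f (s _ + _)]rmorphD rmorphMn /= p_B' addr0 sK.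
    by rewrite mulrDl mulrDr mulrnBl mulrnAr mulrnAl opprD addrACA.
  by rewrite zE rmorphD rmorphMn /= p_B' addr0.
exists d; split=> // x y.
  have -> : x + y = f (s x + s y) by rewrite rmorphD /= !sK.
  rewrite (dE _ (br (s x) + br (s y))) ?rmorphD //.
  by rewrite mulrDl mulrDr opprD addrACA !brE mulrnDl.
have -> : x * y = f (s x * s y) by rewrite rmorphM /= !sK.
rewrite (dE _ (br (s x) * s y + s x * br (s y))).
  by rewrite rmorphD !rmorphM /= !sK.
rewrite mulrnDl -mulrnAl -mulrnAr -!brE mulrBl mulrBr !mulrA.
by rewrite [RHS]addrC addrA addrNK.
Qed.
End HamiltonianDerivation.

Section DerivationOnCentre.
Variables (R : comNzRingType) (n : nat).
Local Notation p := n.+1.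
Hypothesis pR : p \in [pchar R].
Local Notation W := (diffop R).
Local Notation C := {poly {poly R}}.
Variable d : W -> W.
Hypothesis dD : {morph d : x y / x + y}.
Hypothesis dM : forall x y, d (x * y) = d x * y + x * d y.
Hypothesis dC : forall c : R, d (opC c%:P) = 0.
Local Notation iota := (centre_embed pR).

(** A derivation that kills the scalars acts on the centre by the chain rule. *)
Lemma derivation_centre P :
  d (iota P) = iota P^`() * d (opV R ^+ p) + iota (inner_deriv P) * d (opU R ^+ p).
Proof.
have d0 : d 0 = 0 by have := dC 0; rewrite polyC0 rmorph0.
elim/poly_ind: P => [|P a IHP].
  by rewrite /inner_deriv map_poly0 deriv0 rmorph0 !mul0r addr0.
rewrite derivD derivM derivX derivC addr0 mulr1 inner_derivD inner_derivMX inner_derivC.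
rewrite !(rmorphD, rmorphM) /= centre_embedX dD dM IHP !mulrDl.
rewrite -!mulrA !(comm_opVp pR (d _)) -!addrA; congr (_ + _).
rewrite addrCA; congr (_ + _); congr (_ + _).
rewrite !centre_embedC.
elim/poly_ind: a => [|a c IHa]; first by rewrite deriv0 !comp_poly0 rmorph0 mul0r.
rewrite derivD derivM derivX derivC addr0 mulr1.
rewrite !(comp_polyD, comp_polyM, comp_polyX, comp_polyC) !(rmorphD, rmorphM, rmorphXn) /=.
rewrite dD dC addr0 dM IHa -/(opU R) mulrDl -!mulrA; congr (_ + _).
by rewrite (comm_opUp pR).
Qed.
End DerivationOnCentre.

Lemma map_poly_surj (A R : nzRingType) (f : {rmorphism A -> R}) :
  (forall y, exists x, f x = y) -> forall q, exists r, map_poly f r = q.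
Proof.
move=> f_surj q; elim/poly_ind: q => [|q c [r <-]]; first by exists 0; rewrite rmorph0.
have [x <-] := f_surj c; exists (r * 'X + x%:P).
by rewrite rmorphD rmorphM /= map_polyX map_polyC.
Qed.

Lemma map_poly_ker (A R : nzRingType) (f : {rmorphism A -> R}) p :
    (forall x, f x = 0 -> exists y, x = y *+ p) ->
  forall q, map_poly f q = 0 -> exists r, q = r *+ p.
Proof.
move=> f_ker q fq; have /choice[g gE] : forall i, exists y, q`_i = y *+ p.
  by move=> i; apply: f_ker; rewrite -coef_map fq coef0.
exists (\poly_(i < size q) g i); apply/polyP=> i.
rewrite coefMn coef_poly; case: ltnP => [_ | le_qi]; first exact: gE.
by rewrite nth_default // mul0rn.
Qed.

Section Jacobian.
Variables (A R : comNzRingType) (f : {rmorphism A -> R}) (n : nat).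
Local Notation p := n.+1.
Hypothesis pR : p \in [pchar R].
Hypothesis f_surj : forall y, exists x, f x = y.
Hypothesis f_ker : forall x, f x = 0 -> exists y, x = y *+ p.
Hypothesis p_tf : forall x : A, x *+ p = 0 -> x = 0.
Local Notation iota := (centre_embed pR).
Local Notation fW := (map_op f).

Lemma map_op_surj y : exists x, fW x = y.
Proof. exact: (map_poly_surj (f := map_poly f) (map_poly_surj f_surj)). Qed.

Lemma map_op_ker x : fW x = 0 -> exists y, x = y *+ p.
Proof. exact: (map_poly_ker (f := map_poly f) (map_poly_ker f_ker)). Qed.

Lemma diffop_tf (x : diffop A) : x *+ p = 0 -> x = 0.
Proof.
move/diffopP=> xp0; apply/diffopP=> j; apply/polyP=> i.
have := congr1 (fun a : {poly A} => a`_i) (xp0 j).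
by rewrite opcoefMn coefMn /opcoef !coef0 => /p_tf.
Qed.

Lemma diffop_p (y : diffop R) : y *+ p = 0.
Proof. by rewrite -mulr_natr (pcharf0 (pcharW pR)) mulr0. Qed.

Lemma central_derivation w : (forall x, fW w * x = x * fW w) ->
  exists d : diffop R -> diffop R,
  (forall P, d (iota P) = iota P^`() * d (opV R ^+ p) + iota (inner_deriv P) * d (opU R ^+ p))
  /\ (forall x z, x * w - w * x = z *+ p -> d (fW x) = fW z).
Proof.
move=> w_central.
have [|d [dD dM dE]] := hamiltonian_derivation map_op_surj map_op_ker diffop_tf
  diffop_p (w := w).
  by move=> x; rewrite !rmorphM /= w_central.
exists d; split=> //; apply: derivation_centre => // c.
have [c' <-] := f_surj c.
have -> : opC (f c')%:P = fW (opC c'%:P) by rewrite map_opC map_polyC.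
rewrite (dE _ 0) ?rmorph0 // mul0rn; apply/eqP; rewrite subr_eq0; apply/eqP.
by rewrite -[c'%:P]alg_polyC linearZ /= rmorph1 -scalerAl -scalerAr mul1r mulr1.
Qed.

Lemma coprime_fact_pred : coprime (p.-1)`! p.
Proof.
have p_pr : prime p := pcharf_prime pR.
rewrite coprime_sym prime_coprime //=.
suff pN m : (m < p)%N -> ~~ (p %| m`!)%N by exact: pN.
elim: m => [|m IHm] lt_mp; first by rewrite dvdn1 neq_ltn prime_gt1 ?orbT.
by rewrite factS Euclid_dvdM // negb_or IHm ?(ltnW lt_mp) // andbT gtnNdvd.
Qed.

(** The bracket of D^p and S^p is (p - 1)!, and so is that of v^p and u^p.  By
    the chain rule in each argument the Jacobian is the quotient of the two. *)
Lemma centre_jacobian (D S : diffop A) Pd Ps :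
    D * S - S * D = 1 ->
    fW D ^+ p = iota Pd -> fW S ^+ p = iota Ps ->
  Pd^`() * inner_deriv Ps - inner_deriv Pd * Ps^`() = 1.
Proof.
move=> DS DPd SPs; have p_pr : prime p := pcharf_prime pR.
set c := (p.-1)`!.
have powE (y x : diffop A) : y * x - x * y = 1 ->
    exists2 z, fW z = c%:R & y ^+ p * x ^+ p - x ^+ p * y ^+ p = z *+ p.
  move=> yx; have [E EE] := comm_pow_prime p_pr yx; exists (c%:R + E *+ p) => //.
  by rewrite rmorphD rmorphMn rmorphMn rmorph1 /= diffop_p addr0.
have [z1 z1c DSz] := powE _ _ DS.
have [z2 z2c VUz] := powE _ _ (opVU A).
have fVp : fW (opV A ^+ p) = opV R ^+ p by rewrite rmorphXn /= map_opV.
have fUp : fW (opU A ^+ p) = opU R ^+ p by rewrite rmorphXn /= map_opU.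
have fSp : fW (S ^+ p) = iota Ps by rewrite rmorphXn.
have fDp : fW (D ^+ p) = iota Pd by rewrite rmorphXn.
have central_z w P : fW w = iota P -> forall x, fW w * x = x * fW w.
  by move=> -> x; apply: centre_embed_central.
have swap (a b z : diffop A) : a * b - b * a = z *+ p -> b * a - a * b = (- z) *+ p.
  by move=> abz; rewrite mulNrn -abz opprB.
have [dS [dSP dSE]] := central_derivation (central_z _ _ fSp).
have [dV [dVP dVE]] : exists d : diffop R -> diffop R, _ :=
  central_derivation (w := opV A ^+ p)
    ltac:(by move=> x; rewrite fVp (comm_opVp pR)).
have [dU [dUP dUE]] : exists d : diffop R -> diffop R, _ :=
  central_derivation (w := opU A ^+ p)
    ltac:(by move=> x; rewrite fUp (comm_opUp pR)).
have dVV : dV (opV R ^+ p) = 0.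
  by rewrite -fVp (dVE _ 0) ?rmorph0 // subrr mul0rn.
have dUU : dU (opU R ^+ p) = 0.
  by rewrite -fUp (dUE _ 0) ?rmorph0 // subrr mul0rn.
have dVU : dV (opU R ^+ p) = - c%:R.
  by rewrite -fUp (dVE _ _ (swap _ _ _ VUz)) rmorphN /= z2c.
have dUV : dU (opV R ^+ p) = c%:R by rewrite -fVp (dUE _ _ VUz).
(* The bracket of w with S^p, read off in its other argument. *)
have exch w d (x : diffop A) :
    (forall x z, x * w - w * x = z *+ p -> d (fW x) = fW z) ->
    (forall y, fW w * y = y * fW w) -> dS (fW w) = - d (iota Ps).
  move=> dE w_c; have [z zE] : exists z, w * S ^+ p - S ^+ p * w = z *+ p.
    by apply: map_op_ker; rewrite rmorphB !rmorphM /= w_c subrr.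
  by rewrite (dSE _ _ zE) -fSp (dE _ _ (swap _ _ _ zE)) rmorphN opprK.
have dSV : dS (opV R ^+ p) = c%:R * iota (inner_deriv Ps).
  rewrite -fVp (exch _ dV 0 dVE); last by move=> y; rewrite fVp (comm_opVp pR).
  by rewrite dVP dVV dVU mulr0 add0r mulrN opprK mulr_natl mulr_natr.
have dSU : dS (opU R ^+ p) = - (c%:R * iota Ps^`()).
  rewrite -fUp (exch _ dU 0 dUE); last by move=> y; rewrite fUp (comm_opUp pR).
  by rewrite dUP dUU dUV mulr0 addr0 mulr_natl mulr_natr.
have := dSE _ _ DSz; rewrite fDp dSP dSV dSU z1c mulrN.
rewrite !mulr_natl !mulrnAr -!rmorphM -mulrnBl -rmorphB => /eqP.
rewrite -subr_eq0 -mulrnBl -(rmorph1 iota) -rmorphB => /eqP J0.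
apply/eqP; rewrite -subr_eq0; apply/eqP/(centre_embed_inj (pR := pR)).
by rewrite [RHS]rmorph0; apply: (pchar_coprime_mulrn pR coprime_fact_pred).
Qed.
End Jacobian.

(** * Degrees and parity in the centre *)

Section Degrees.
Variable R : comNzRingType.
Local Notation W := (diffop R).
Implicit Types (x y : W).

Definition udeg_le (m : nat) x := forall j, (size (opcoef x j) <= m.+1)%N.

Lemma udeg_leM m1 m2 x y : udeg_le m1 x -> udeg_le m2 y -> udeg_le (m1 + m2) (x * y).
Proof.
elim/diffop_ind: x y => [|x a IHx] y le_x le_y j.
  by rewrite mul0r /opcoef coef0 size_poly0.
have le_x' : udeg_le m1 x.
  by move=> i; have := le_x i.+1; rewrite opcoefD opcoef_mulV opcoefC addr0.
have le_a : (size a <= m1.+1)%N.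
  by have := le_x 0%N; rewrite opcoefD opcoef_mulV opcoefC add0r.
have le_Vy : udeg_le m2 (opV R * y).
  move=> i; rewrite opcoef_Vmul (leq_trans (size_polyD _ _)) // geq_max.
  rewrite (leq_trans (size_poly _ _)) ?(leq_trans (leq_pred _)) ?le_y // andbT.
  by case: eqP; rewrite ?size_poly0 ?le_y.
rewrite mulrDl -mulrA opcoefD opcoef_Cmul (leq_trans (size_polyD _ _)) // geq_max.
rewrite IHx //= (leq_trans (size_polyMleq _ _)) //.
by rewrite -subn1 leq_subLR (leq_trans (leq_add le_a (le_y j))) // addSn addnS.
Qed.

Lemma udeg_leX m x k : udeg_le m x -> udeg_le (m * k) (x ^+ k).
Proof.
move=> le_x; elim: k => [|k IHk].
  move=> j; rewrite expr0 -(rmorph1 (@opC R)) opcoefC; case: eqP => _.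
    by rewrite size_poly1.
  by rewrite size_poly0.
by rewrite exprS mulnS; apply: udeg_leM.
Qed.

Definition vdeg_le (m : nat) x := forall j, (m < j)%N -> opcoef x j = 0.

Lemma vdeg_leM m1 m2 x y : vdeg_le m1 x -> vdeg_le m2 y ->
  vdeg_le (m1 + m2) (x * y) /\
  opcoef (x * y) (m1 + m2) = opcoef x m1 * opcoef y m2.
Proof.
elim/diffop_ind: x y m1 m2 => [|x a IHx] y m1 m2 le_x le_y.
  by rewrite mul0r /opcoef !coef0 mul0r; split=> // j _; rewrite /opcoef coef0.
have coefx j : opcoef x j = opcoef (x * opV R + opC a) j.+1.
  by rewrite opcoefD opcoef_mulV opcoefC addr0.
case: m1 le_x => [|m1] le_x.
  have -> : x = 0 by apply/diffopP => j; rewrite coefx le_x // /opcoef coef0.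
  rewrite mul0r add0r add0n; split=> [j lt_j|]; rewrite opcoef_Cmul ?opcoefC //.
  by rewrite le_y // mulr0.
have le_x' : vdeg_le m1 x by move=> j lt_j; rewrite coefx le_x.
have le_Vy : vdeg_le m2.+1 (opV R * y).
  move=> [|j] // lt_j; rewrite opcoef_Vmul /= !le_y ?deriv0 ?addr0 //.
  exact: ltnW.
have [le_xy xyE] := IHx (opV R * y) m1 m2.+1 le_x' le_Vy.
rewrite mulrDl -mulrA addSnnS; split=> [j lt_j|].
  rewrite opcoefD opcoef_Cmul le_xy // add0r le_y ?mulr0 //.
  by apply: leq_ltn_trans lt_j; rewrite addnS ltnW // ltnS leq_addl.
rewrite opcoefD opcoef_Cmul xyE opcoef_Vmul /= (le_y m2.+1) // deriv0 addr0 coefx.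
by rewrite (le_y (m1 + m2.+1)%N) ?mulr0 ?addr0 // leq_addl.
Qed.

Lemma vdeg_leX m x k : vdeg_le m x ->
  vdeg_le (m * k) (x ^+ k) /\ opcoef (x ^+ k) (m * k) = opcoef x m ^+ k.
Proof.
move=> le_x; elim: k => [|k [le_xk xkE]].
  rewrite muln0 !expr0 -(rmorph1 (@opC R)); split=> [j|]; rewrite opcoefC //.
  by case: j.
by rewrite exprS mulnS exprS -xkE; apply: vdeg_leM.
Qed.
End Degrees.

Section AdjointCentre.
Variables (R : comNzRingType) (n : nat).
Local Notation p := n.+1.
Hypothesis pR : p \in [pchar R].
Hypothesis odd_p : odd p.
Local Notation iota := (centre_embed pR).

(** For p odd the adjoint negates v^p and fixes u^p. *)
Lemma op_adj_centre P : op_adj (iota P) = iota (P \Po (- 'X)).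
Proof.
elim/poly_ind: P => [|P a IHP]; first by rewrite comp_poly0 !rmorph0 op_adj0.
rewrite comp_polyD comp_polyM comp_polyX comp_polyC !(rmorphD, rmorphM, rmorphN) /=.
rewrite op_adjD op_adjM IHP centre_embedX op_adjX op_adjV centre_embedC op_adjC.
by rewrite exprNn -signr_odd odd_p expr1 mulN1r mulNr mulrN (comm_opVp pR).
Qed.

End AdjointCentre.

Lemma coef_comp_NX (R : comNzRingType) (P : {poly R}) j :
  (P \Po (- 'X))`_j = (-1) ^+ j * P`_j.
Proof.
elim/poly_ind: P j => [|P a IHP] j; first by rewrite comp_poly0 !coef0 mulr0.
rewrite comp_polyD comp_polyM comp_polyX comp_polyC mulrN !(coefD, coefN, coefMX, coefC).
by case: j => [|j] /=; rewrite ?mul1r ?oppr0 // !addr0 IHP exprS mulN1r mulNr.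
Qed.

(** * Jacobian pairs with an odd component *)

Lemma coef2M (R : nzRingType) (P Q : {poly {poly R}}) J I :
  (P * Q)`_J`_I =
    \sum_(b < J.+1) \sum_(a < I.+1) P`_b`_a * Q`_(J - b)`_(I - a).
Proof. by rewrite coefM coef_sum; apply: eq_bigr => b _; rewrite coefM. Qed.

(** The coefficients of U V times the Jacobian, in which the Euler derivations
    replace the partial derivatives, so that no exponent is shifted. *)
Lemma bracket_coef (R : comNzRingType) (s d : {poly {poly R}}) J I :
    d^`() * inner_deriv s - inner_deriv d * s^`() = 1 ->
  \sum_(b < J.+1) \sum_(a < I.+1)
    (d`_b`_a * s`_(J - b)`_(I - a) *+ (b * (I - a)) -
     d`_b`_a * s`_(J - b)`_(I - a) *+ (a * (J - b))) = ((J == 1) && (I == 1))%:R.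
Proof.
move=> jac.
have dvE (P : {poly {poly R}}) b : (P^`() * 'X)`_b = P`_b *+ b.
  by rewrite coefMX; case: b => [|b] //=; rewrite coef_deriv.
have duE (P : {poly {poly R}}) b a : (inner_deriv P * ('X)%:P)`_b`_a = P`_b`_a *+ a.
  by rewrite coefMC inner_derivE coefMX; case: a => [|a] //=; rewrite coef_deriv.
have : (d^`() * 'X) * (inner_deriv s * ('X)%:P)
     - (inner_deriv d * ('X)%:P) * (s^`() * 'X) = 'X * ('X)%:P.
  rewrite -[RHS]mul1r -jac mulrBl; congr (_ - _); rewrite -!mulrA; congr (_ * _).
    by rewrite mulrCA.
  by rewrite mulrCA [_%:P * _]mulrC.
move/(congr1 (fun P : {poly {poly R}} => P`_J`_I)).
have -> : ('X * ('X : {poly R})%:P : {poly {poly R}})`_J`_I = ((J == 1) && (I == 1))%:R.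
  by rewrite coefMC coefX; case: (J == 1); rewrite ?mul1r ?mul0r ?coefX ?coef0.
move=> <-; rewrite !coefB !coef2M -sumrB; apply: eq_bigr => b _.
rewrite -sumrB; apply: eq_bigr => a _.
rewrite !duE !dvE !coefMn; congr (_ - _).
  by rewrite mulrnAl mulrnAr -mulrnA mulnC.
by rewrite mulrnAl mulrnAr -mulrnA mulnC.
Qed.

Lemma max_first (Q : nat -> nat -> Prop) N :
    (forall j i, Q j i -> (j <= N)%N) -> (exists j i, Q j i) ->
  exists j i, Q j i /\ forall j' i', Q j' i' -> (j' <= j)%N.
Proof.
move=> Q_le [j0 [i0 Q0]].
have exQ : exists j, `[< exists i, Q j i >] by exists j0; apply/asboolP; exists i0.
have Q_ub j : `[< exists i, Q j i >] -> (j <= N)%N.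
  by move=> /asboolP[i]; apply: Q_le.
have [j /asboolP[i Qji] j_max] := ex_maxnP exQ Q_ub.
by exists j, i; split=> // j' i' Q'; apply: j_max; apply/asboolP; exists i'.
Qed.

(** The two inequalities add up to an equality, so neither can be strict. *)
Lemma opposite_points (t : rat) (j1 i1 j2 i2 b a : nat) :
    (b <= j1 + j2)%N -> (a <= i1 + i2)%N ->
    i1%:R + t * j1%:R = 1 -> i2%:R + t * j2%:R = t ->
    a%:R + t * b%:R <= t ->
    (i1 + i2 - a)%:R + t * (j1 + j2 - b)%:R <= 1 ->
  a%:R + t * b%:R = t /\ (i1 + i2 - a)%:R + t * (j1 + j2 - b)%:R = 1.
Proof. by move=> le_b le_a; rewrite !natrB // !natrD; split; lra. Qed.

Lemma pchar_mulrn_inj (k : idomainType) p (x : k) m1 m2 :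
    p \in [pchar k] -> x != 0 -> (m1 < p)%N -> (m2 < p)%N ->
  x *+ m1 = x *+ m2 -> m1 = m2.
Proof.
move=> pk x_n0; wlog le_m : m1 m2 / (m1 <= m2)%N => [hw lt1 lt2 e|_ lt2 e].
  by case/orP: (leq_total m1 m2) => le_m; [apply: hw | apply/esym/hw].
apply/eqP; rewrite eqn_leq le_m /= -subn_eq0 -leqn0 leqNgt; apply/negP => m_gt0.
have : x *+ (m2 - m1) = 0 by rewrite mulrnBr // e subrr.
move/(@pchar_coprime_mulrn k k^o p _ _ pk); rewrite coprime_sym.
rewrite prime_coprime ?(pcharf_prime pk) // gtnNdvd //; last first.
  by rewrite (leq_ltn_trans _ lt2) // leq_subr.
by move/(_ isT)/eqP; rewrite (negPf x_n0).
Qed.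

Section Corner.
Variables (k : idomainType) (p N : nat) (s d : {poly {poly k}}).
Hypothesis pk : p \in [pchar k].
Hypothesis ltNp : (N.+1 * N.+1 < p)%N.
Hypothesis s_le : forall j i, s`_j`_i != 0 -> (j <= N)%N /\ (i <= N)%N.
Hypothesis d_le : forall j i, d`_j`_i != 0 -> (j <= N)%N /\ (i <= N)%N.
Hypothesis d_odd : forall j, ~~ odd j -> d`_j = 0.
Hypothesis jac : d^`() * inner_deriv s - inner_deriv d * s^`() = 1.

(** The Jacobian on the line V = 0 is d_1 s_0', because d has no constant term
    in V. *)
Lemma axis_coefs :
  [/\ s`_0`_1 != 0, forall i, (1 < i)%N -> s`_0`_i = 0,
      d`_1`_0 != 0 & forall i, (0 < i)%N -> d`_1`_i = 0].
Proof.
have ds1 : d`_1 * (s`_0)^`() = 1.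
  have := congr1 (fun P : {poly {poly k}} => P`_0) jac.
  rewrite coefB !coefM !big_ord1 !subn0 !coef_deriv !inner_derivE coef1.
  by rewrite (d_odd (j := 0)) // deriv0 mul0r subr0 mulr1n.
have d1_n0 : d`_1 != 0.
  by apply: contra_eq_neq ds1 => ->; rewrite mul0r eq_sym oner_neq0.
have s0_n0 : (s`_0)^`() != 0.
  by apply: contra_eq_neq ds1 => ->; rewrite mulr0 eq_sym oner_neq0.
have := congr1 (fun P : {poly k} => size P) ds1; rewrite /= size_poly1 size_mul //.
move: (d1_n0) (s0_n0); rewrite -!size_poly_gt0 => d1_gt0 s0_gt0 sz.
have add_eq2 a b : (0 < a)%N -> (0 < b)%N -> (a + b).-1 = 1%N -> a = 1%N /\ b = 1%N.
  by lia.
have [sz_d sz_s] := add_eq2 _ _ d1_gt0 s0_gt0 sz.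
have sE : (s`_0)^`()`_0 = s`_0`_1 by rewrite coef_deriv.
split.
- by move: s0_n0; rewrite -lead_coef_eq0 lead_coefE sz_s sE.
- move=> [|[|i]] // _; apply/eqP; apply/negPn/negP => si_n0.
  have [_ le_iN] := s_le si_n0.
  have := coef_deriv s`_0 i.+1; rewrite nth_default ?sz_s // => /esym.
  move/(@pchar_coprime_mulrn k k^o p i.+2 _ pk); rewrite coprime_sym.
  rewrite prime_coprime ?(pcharf_prime pk) // gtnNdvd //; last by nia.
  by move/(_ isT)/eqP; rewrite (negPf si_n0).
- by move: d1_n0; rewrite -lead_coef_eq0 lead_coefE sz_d.
- by move=> i i_gt0; rewrite nth_default ?sz_d.
Qed.

Lemma skew_row_gt1 j i : d`_j`_i != 0 -> ~ (j = 1%N /\ i = 0%N) -> (1 < j)%N.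
Proof.
have [_ _ _ d1_0] := axis_coefs.
case: j => [|[|j]] //; first by rewrite (d_odd (j := 0)) // coef0 eqxx.
by case: i => [|i] d_n0 n10; [case: n10 | rewrite d1_0 ?eqxx in d_n0].
Qed.

(** The first weight t of V for which a monomial of s other than U, or one of d
    other than V, reaches the weight of U, respectively of V. *)
Lemma supporting_slope j0 i0 : d`_j0`_i0 != 0 -> (1 < j0)%N ->
  exists t : rat,
    [/\ forall j i, s`_j`_i != 0 -> i%:R + t * j%:R <= 1,
        forall j i, d`_j`_i != 0 -> i%:R + t * j%:R <= t
      & (exists j i, [/\ s`_j`_i != 0, (0 < j)%N & i%:R + t * j%:R = 1]) \/
        (exists j i, [/\ d`_j`_i != 0, (1 < j)%N & i%:R + t * j%:R = t])].
Proof.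
have [s01 s0_0 d10 d1_0] := axis_coefs.
move=> d00 gt_j0.
pose T : finType := (bool * ('I_N.+1 * 'I_N.+1))%type.
(* The weight at which a monomial catches up, for s (false) and for d (true);
   the exponents are listed with that of V first. *)
pose slope (x : T) : rat :=
  if x.1 then - (x.2.2)%:R / ((x.2.1)%:R - 1) else (1 - (x.2.2)%:R) / (x.2.1)%:R.
pose Q (x : T) := if x.1 then (d`_x.2.1`_x.2.2 != 0) && (1 < x.2.1)%N
                  else (s`_x.2.1`_x.2.2 != 0) && (0 < x.2.1)%N.
have [le_j0 le_i0] := d_le d00.
pose x0 : T := (true, (inord j0, inord i0)).
have Qx0 : Q x0 by rewrite /Q /= !inordK // d00.
case: (arg_minP slope Qx0) => x Qx x_min; exists (slope x).
split=> [j i sji|j i dji|].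
- have [le_j le_i] := s_le sji; case: j => [|j] in sji le_j *.
    rewrite mulr0 addr0; case: i => [|[|i]] // in sji le_i *.
    by rewrite s0_0 // eqxx in sji.
  have := x_min (false, (inord j.+1, inord i)); rewrite /Q /= !inordK // sji.
  move=> /(_ isT); rewrite {2}/slope /= !inordK // ler_pdivlMr ?ltr0n //.
  by rewrite lerBrDl.
- have [le_j le_i] := d_le dji.
  have [[-> ->]|n10] := pselect (j = 1%N /\ i = 0%N); first by rewrite mulr1 add0r.
  have gt_j := skew_row_gt1 dji n10.
  have := x_min (true, (inord j, inord i)); rewrite /Q /= !inordK // dji gt_j.
  move=> /(_ isT); rewrite {2}/slope /= !inordK // ler_pdivlMr ?subr_gt0 ?ltr1n //.
  by rewrite mulrBr mulr1; lra.
case: x Qx {x_min} => -[] [j i]; rewrite /Q /slope /= => /andP[ne0 gt_j].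
  right; exists j, i; split=> //.
  have j_n1 : (j%:R - 1 : rat) != 0 by rewrite subr_eq0 gt_eqF // ltr1n.
  by have := divfK j_n1 (- i%:R); set q := _ / _; lra.
left; exists j, i; split=> //.
by rewrite divfK ?pnatr_eq0 -?lt0n // addrC subrK.
Qed.

(** On the two supporting lines take the monomials U^i1 V^j1 of s and U^i2 V^j2
    of d of highest degree in V.  No other pair of monomials contributes to the
    coefficient of their product, so j2 i1 = i2 j1 in the field and hence, the
    exponents being small, in the integers.  With i1 + t j1 = 1 and
    i2 + t j2 = t this gives j2 = t j1, then j2 = 1, i1 = 0 and t > 0.  But for
    t > 0 the monomial V is the only odd one of weight at most t. *)
Lemma corner_rigidity j i : d`_j`_i != 0 -> j = 1%N /\ i = 0%N.
Proof.
move=> dji; have [// | ji_n10] := pselect (j = 1%N /\ i = 0%N); exfalso.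
have [s01 s0_0 d10 d1_0] := axis_coefs.
have gt_j := skew_row_gt1 dji ji_n10.
have [t [sP dP onP]] := supporting_slope dji gt_j.
have [||j1 [i1 [[s1 e1] max1]]] := @max_first
  (fun j i => s`_j`_i != 0 /\ i%:R + t * j%:R = 1) N.
- by move=> j' i' [/s_le[]].
- by exists 0%N, 1%N; rewrite mulr0 addr0.
have [||j2 [i2 [[d2 e2] max2]]] := @max_first
  (fun j i => d`_j`_i != 0 /\ i%:R + t * j%:R = t) N.
- by move=> j' i' [/d_le[]].
- by exists 1%N, 0%N; rewrite mulr1 add0r.
have j2_gt0 : (0 < j2)%N.
  by case: j2 d2 {e2 max2} => //; rewrite (d_odd (j := 0)) // coef0 eqxx.
(* The monomial that defines the slope is on one of the lines and is higher
   than U, respectively V; so the product of the two corners is not U V. *)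
have j12 : (1 < j1 + j2)%N.
  case: onP => [] [j' [i' [n0 gt_j' e']]].
    have := max1 _ _ (conj n0 e'); lia.
  have := max2 _ _ (conj n0 e'); lia.
have [le_j1 le_i1] := s_le s1; have [le_j2 le_i2] := d_le d2.
have par : (j2 * i1 = i2 * j1)%N.
  have := bracket_coef (j1 + j2) (i1 + i2) jac.
  have -> : (j1 + j2 == 1)%N = false by rewrite gtn_eqF.
  have lt_b : (j2 < (j1 + j2).+1)%N by rewrite ltnS leq_addl.
  have lt_a : (i2 < (i1 + i2).+1)%N by rewrite ltnS leq_addl.
  have only b a : (b <= j1 + j2)%N -> (a <= i1 + i2)%N ->
      d`_b`_a * s`_(j1 + j2 - b)`_(i1 + i2 - a) != 0 -> b = j2 /\ a = i2.
    move=> le_b le_a; rewrite mulf_eq0 => /norP[db sb].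
    have [eb es] := opposite_points le_b le_a e1 e2 (dP _ _ db) (sP _ _ sb).
    have le_bj := max2 _ _ (conj db eb); have le_bj' := max1 _ _ (conj sb es).
    have b_j2 : b = j2 by clear -le_b le_bj le_bj'; lia.
    rewrite b_j2 in eb *.
    by split=> //; apply/eqP; rewrite -(eqr_nat rat); apply/eqP; lra.
  rewrite (bigD1 (Ordinal lt_b)) //= [X in _ + X]big1 => [|b ne_b]; last first.
    apply: big1 => a _.
    have [->|n0] := eqVneq (d`_b`_a * s`_(j1 + j2 - b)`_(i1 + i2 - a)) 0.
      by rewrite !mul0rn subrr.
    have [b_j2 _] := only b a (leq_ord b) (leq_ord a) n0.
    by case/eqP: ne_b; apply: val_inj.
  rewrite addr0 (bigD1 (Ordinal lt_a)) //= [X in _ + X]big1 => [|a ne_a]; last first.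
    have [->|n0] := eqVneq (d`_j2`_a * s`_(j1 + j2 - j2)`_(i1 + i2 - a)) 0.
      by rewrite !mul0rn subrr.
    have [_ a_i2] := only j2 a (leq_addl _ _) (leq_ord a) n0.
    by case/eqP: ne_a; apply: val_inj.
  rewrite addr0 !addnK => /eqP; rewrite subr_eq0 => /eqP.
  have lt_p m1 m2 : (m1 <= N)%N -> (m2 <= N)%N -> (m1 * m2 < p)%N.
    move=> le1 le2; apply: leq_ltn_trans (leq_mul le1 le2) _.
    by apply: leq_ltn_trans ltNp; apply: leq_mul.
  by apply: (pchar_mulrn_inj pk); rewrite ?lt_p // mulf_neq0.
have parR : (j2%:R * i1%:R = i2%:R * j1%:R :> rat) by rewrite -!natrM par.
have j2E : (j2%:R = t * j1%:R :> rat).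
  rewrite -[LHS]mulr1 -[X in _ * X = _]e1 mulrDr parR -[in RHS]e2.
  by ring.
have j2_ge1 : (1 <= j2%:R :> rat) by rewrite ler1n.
have i1_ge0 : (0 <= i1%:R :> rat) by rewrite ler0n.
have j1_ge0 : (0 <= j1%:R :> rat) by rewrite ler0n.
have t_gt0 : 0 < t.
  rewrite ltNge; apply/negP => t_le0.
  by have := mulr_le0_ge0 t_le0 j1_ge0; lra.
have := dP _ _ dji; have : (0 <= i%:R :> rat) by rewrite ler0n.
have : (1 < j%:R :> rat) by rewrite ltr1n.
rewrite -(ltr_pM2l t_gt0) mulr1; lra.
Qed.
End Corner.

(** * The leading term of a skew operator modulo p *)

Section MapCentre.
Variables (R k : comNzRingType) (g : {rmorphism R -> k}) (n : nat).
Local Notation p := n.+1.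
Hypotheses (pR : p \in [pchar R]) (pk : p \in [pchar k]).

Lemma map_centre P :
  map_op g (centre_embed pR P) = centre_embed pk (map_poly (map_poly g) P).
Proof.
apply/diffopP=> j; apply/polyP=> i; rewrite opcoef_map coef_map !coef_centre.
by case: ifP => _; [rewrite !coef_map | apply: rmorph0].
Qed.

Lemma map_inner_deriv P :
  map_poly (map_poly g) (inner_deriv P) = inner_deriv (map_poly (map_poly g) P).
Proof.
by apply/polyP=> j; rewrite coef_map !inner_derivE coef_map deriv_map.
Qed.
End MapCentre.

Section CentreDegrees.
Variables (k : comNzRingType) (n : nat).
Local Notation p := n.+1.
Hypothesis pk : p \in [pchar k].
Local Notation iota := (centre_embed pk).

Lemma centre_coef_le N (x : diffop k) P : x ^+ p = iota P ->
  vdeg_le N x -> udeg_le N x ->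
  forall j i, P`_j`_i != 0 -> (j <= N)%N /\ (i <= N)%N.
Proof.
move=> xP le_v le_u j i Pji.
have [le_vp _] := vdeg_leX p le_v; have le_up := udeg_leX p le_u.
have cE : (opcoef (x ^+ p) (j * p))`_(i * p) = P`_j`_i.
  by rewrite xP coef_centre !dvdn_mull //= !mulnK.
rewrite -(leq_pmul2r (isT : 0 < p)%N) -[(i <= N)%N](leq_pmul2r (isT : 0 < p)%N).
split; rewrite leqNgt; apply/negP => lt; case/eqP: Pji; rewrite -cE.
  by rewrite le_vp // coef0.
by rewrite nth_default // (leq_trans (le_up _)).
Qed.

Lemma centre_skew_odd (x : diffop k) P : odd p ->
    (forall c : k, c *+ 2 = 0 -> c = 0) ->
    x ^+ p = iota P -> op_adj x = - x ->
  forall j, ~~ odd j -> P`_j = 0.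
Proof.
move=> odd_p two_tf xP x_adj j odd_j.
have : op_adj (iota P) = iota (- P).
  rewrite -xP op_adjX x_adj exprNn -signr_odd odd_p expr1 mulN1r xP.
  by rewrite centre_embedN.
rewrite op_adj_centre //.
move/(centre_embed_inj (pR := pk))/(congr1 (fun Q : {poly {poly k}} => Q`_j)).
rewrite coef_comp_NX -signr_odd (negPf odd_j) mul1r coefN => /eqP.
rewrite -addr_eq0 -mulr2n => /eqP P2; apply/polyP=> i.
by rewrite coef0; apply: two_tf; rewrite -coefMn P2 coef0.
Qed.
End CentreDegrees.

Section CharpRigidity.
Variables (A R : comNzRingType) (k : idomainType).
Variables (f : {rmorphism A -> R}) (g : {rmorphism R -> k}) (n N m : nat).
Local Notation p := n.+1.
Hypothesis pR : p \in [pchar R].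
Hypothesis f_surj : forall y, exists x, f x = y.
Hypothesis f_ker : forall x, f x = 0 -> exists y, x = y *+ p.
Hypothesis p_tf : forall x : A, x *+ p = 0 -> x = 0.
Hypothesis odd_p : odd p.
Hypothesis ltNp : (N.+1 * N.+1 < p)%N.
Variables (D S : diffop A).
Hypothesis DS : D * S - S * D = 1.
Hypothesis D_adj : op_adj D = - D.
Hypotheses (D_v : vdeg_le N D) (D_u : udeg_le N D).
Hypotheses (S_v : vdeg_le N S) (S_u : udeg_le N S).
Local Notation h x := (map_op g (map_op f x)).

(** Since D^p = d(u^p, v^p) has the leading term of D to the power p, the shape
    d = c V forces D to have order one and constant leading coefficient. *)
Lemma charp_rigidity : vdeg_le m (h D) -> opcoef (h D) m != 0 ->
  m = 1%N /\ size (opcoef (h D) m) = 1%N.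
Proof.
have pk : p \in [pchar k] := rmorph_pchar g pR.
have p_pr := pcharf_prime pR.
have DSR : map_op f D * map_op f S - map_op f S * map_op f D = 1.
  by rewrite -!rmorphM -rmorphB DS rmorph1.
have SDR : map_op f S * (- map_op f D) - (- map_op f D) * map_op f S = 1.
  by rewrite mulrN mulNr opprK addrC.
have [Pd DPd] : exists P, map_op f D ^+ p = centre_embed pR P.
  by apply: centralP; [|symmetry]; apply: (weyl_pow_central pR _ DSR).
have [Ps SPs] : exists P, map_op f S ^+ p = centre_embed pR P.
  by apply: centralP; [|symmetry]; apply: (weyl_pow_central pR _ SDR).
have jac := centre_jacobian f_surj f_ker p_tf DS DPd SPs.
set d := map_poly (map_poly g) Pd; set s := map_poly (map_poly g) Ps.
have hD : h D ^+ p = centre_embed pk d by rewrite -rmorphXn DPd /= (map_centre g pR pk).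
have hS : h S ^+ p = centre_embed pk s by rewrite -rmorphXn SPs /= (map_centre g pR pk).
have jac_k : d^`() * inner_deriv s - inner_deriv d * s^`() = 1.
  rewrite /d /s -!map_inner_deriv !deriv_map -!rmorphM -rmorphB jac rmorph1 //.
have h_v x : vdeg_le N x -> vdeg_le N (h x).
  by move=> le_x j lt_j; rewrite !opcoef_map le_x // !rmorph0.
have h_u x : udeg_le N x -> udeg_le N (h x).
  move=> le_x j; rewrite !opcoef_map.
  by apply: leq_trans (size_poly _ _) (leq_trans (size_poly _ _) (le_x j)).
have two_tf (c : k) : c *+ 2 = 0 -> c = 0.
  apply: (@pchar_coprime_mulrn k k^o p _ _ pk).
  by rewrite prime_coprime // dvdn2 odd_p.
have d_odd j : ~~ odd j -> d`_j = 0.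
  apply: (centre_skew_odd odd_p two_tf hD).
  by rewrite -!map_op_adj D_adj !rmorphN.
have corner := corner_rigidity pk ltNp (centre_coef_le hS (h_v _ S_v) (h_u _ S_u))
  (centre_coef_le hD (h_v _ D_v) (h_u _ D_u)) d_odd jac_k.
move=> D_m Dm_n0; have [_ topE] := vdeg_leX p D_m.
have := opcoef_centre pk d (m * p); rewrite -hD topE dvdn_mull // mulnK // => dmE.
have dm_n0 : d`_m != 0.
  apply: contra_neq Dm_n0 => dm0; apply/eqP.
  have : opcoef (h D) m ^+ p == 0 by rewrite dmE dm0 comp_poly0.
  by rewrite expf_eq0.
(* The leading coefficient of d_m is a nonzero coefficient of d, hence that of V. *)
have m1 : m = 1%N.
  have /corner[] : d`_m`_(size d`_m).-1 != 0 by rewrite -lead_coefE lead_coef_eq0.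
  by [].
split=> //.
have dm_const : d`_m = (d`_m`_0)%:P.
  apply/polyP=> -[|i]; rewrite coefC //=; apply/eqP/negPn/negP => /corner[_].
  by [].
have : size (opcoef (h D) m ^+ p) = 1%N.
  rewrite dmE dm_const comp_polyC size_polyC; case: eqP => // d0.
  by rewrite dm_const d0 eqxx in dm_n0.
move/(congr1 predn); rewrite size_exp /= => /eqP; rewrite muln_eq0 orbF => /eqP sz.
by rewrite (polySpred Dm_n0) sz.
Qed.
End CharpRigidity.

(** * Quotients and residue fields *)

Local Open Scope quotient_scope.

Section QuotientRings.
Variables (R : comNzRingType).

Record proper_ideal_prop (I : R -> Prop) : Prop := ProperIdealProp {
  ideal_prop0 : I 0;
  ideal_propB : forall x y, I x -> I y -> I (x - y);
  ideal_propM : forall a x, I x -> I (a * x);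
  ideal_prop1 : ~ I 1 }.

Section OneIdeal.
Variables (I : R -> Prop) (idI : proper_ideal_prop I).

(** The proof is an argument so that the ideal structure can be inferred from
    the term. *)
Definition ideal_pred of proper_ideal_prop I : {pred R} := fun x => `[< I x >].

Fact ideal_pred_zmod : zmod_closed (ideal_pred idI).
Proof.
split=> [|x y /asboolP Ix /asboolP Iy]; apply/asboolP; first exact: ideal_prop0.
exact: ideal_propB.
Qed.
HB.instance Definition _ :=
  GRing.isZmodClosed.Build R (ideal_pred idI) ideal_pred_zmod.

Fact ideal_pred_proper : 1 \notin ideal_pred idI /\
  (forall a, {in ideal_pred idI, forall u, a * u \in ideal_pred idI}).
Proof.
split=> [|a x]; first by apply/asboolP; apply: ideal_prop1.
by move=> /asboolP Ix; apply/asboolP; apply: ideal_propM.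
Qed.
HB.instance Definition _ :=
  isProperIdeal.Build R (ideal_pred idI) ideal_pred_proper.

Lemma quotient_ring_exists : exists (Q : comNzRingType) (f : {rmorphism R -> Q}),
  (forall y, exists x, f x = y) /\ (forall x, f x = 0 <-> I x).
Proof.
pose Q : comNzRingType := {ideal_quot (ideal_pred idI)}.
pose f (x : R) : Q := \pi_{ideal_quot (ideal_pred idI)} x.
have fB : zmod_morphism f by move=> x y; rewrite /f !piE.
have fM : monoid_morphism f by split=> [|x y]; rewrite /f !piE.
pose fadd := GRing.isZmodMorphism.Build R Q f fB.
pose fmul := GRing.isMonoidMorphism.Build R Q f fM.
exists Q, (HB.pack_for {rmorphism R -> Q} f fadd fmul); split=> [y|x] /=.
  by exists (repr y); exact: reprK.
rewrite /f -(_ : \pi_Q 0 = 0); last by rewrite piE.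
split=> [/eqP|Ix]; first by rewrite -Quotient.idealrBE subr0 => /asboolP.
by apply/eqP; rewrite -Quotient.idealrBE subr0; apply/asboolP.
Qed.
End OneIdeal.

End QuotientRings.

Lemma quotient_by_nat (A : comNzRingType) (p : nat) :
    (forall x : A, x *+ p <> 1) ->
  exists (R : comNzRingType) (f : {rmorphism A -> R}),
  (forall y, exists x, f x = y) /\ (forall x, f x = 0 <-> exists y, x = y *+ p).
Proof.
move=> p_nonunit; apply: quotient_ring_exists; split.
- by exists 0; rewrite mul0rn.
- by move=> x y [x' ->] [y' ->]; exists (x' - y'); rewrite mulrnBl.
- by move=> a x [x' ->]; exists (a * x'); rewrite mulrnAr.
- by move=> [y /esym]; apply: p_nonunit.
Qed.

Lemma maximal_ideal_exists (R : comNzRingType) :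
  exists I : R -> Prop, proper_ideal_prop I /\
    forall x, ~ I x -> exists a, I (1 - a * x).
Proof.
(* The empty set is allowed because it is the union of the empty chain. *)
pose P (I : set R) := I = set0 \/ proper_ideal_prop I.
have [F FP Ftot|I [PI I_max]] := @Zorn_bigcup R P.
  have [F0 | F_ne] := pselect (forall X, F X -> X = set0).
    left; apply/seteqP; split=> // x [X /F0 ->] //.
  have [X0 FX0 X0_id] : exists2 X, F X & proper_ideal_prop X.
    apply: contrapT => noX; apply: F_ne => X FX.
    by have [// | X_id] := FP X FX; case: noX; exists X.
  have id_of X x : F X -> X x -> proper_ideal_prop X.
    by move=> FX Xx; have [X0'|//] := FP X FX; rewrite X0' in Xx.
  right; split.
  - by exists X0 => //; apply: ideal_prop0.
  - move=> x y [X FX Xx] [Y FY Yy].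
    have [XY|YX] := Ftot X Y FX FY.
      by exists Y => //; apply: (ideal_propB (id_of Y y FY Yy)) => //; apply: XY.
    by exists X => //; apply: (ideal_propB (id_of X x FX Xx)) => //; apply: YX.
  - move=> a x [X FX Xx]; exists X => //.
    exact: (ideal_propM (id_of X x FX Xx)).
  - by move=> [X FX X1]; apply: (ideal_prop1 (id_of X 1 FX X1)).
have I_id : proper_ideal_prop I.
  have [I0|//] := PI; exfalso.
  apply: (I_max [set 0]%classic); first by rewrite I0; split=> // /(_ 0); apply.
  right; split=> //.
  - by move=> x y -> ->; rewrite /= subrr.
  - by move=> a x ->; rewrite /= mulr0.
  - by move/eqP; rewrite oner_eq0.
exists I; split=> // x nIx; apply: contrapT => no_a.
apply: (I_max [set y | exists a b, I b /\ y = b + a * x]%classic).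
  split; last first.
    move/(_ x) => sub; apply/nIx/sub; exists 1, 0; rewrite add0r mul1r.
    by split=> //; apply: ideal_prop0.
  by move=> y Iy; exists 0, y; rewrite mul0r addr0.
right; split.
- by exists 0, 0; rewrite mul0r addr0; split=> //; apply: ideal_prop0.
- move=> _ _ [a [b [Ib ->]]] [a' [b' [Ib' ->]]]; exists (a - a'), (b - b').
  by split; [apply: ideal_propB | rewrite mulrBl opprD addrACA].
- move=> c _ [a [b [Ib ->]]]; exists (c * a), (c * b).
  by split; [apply: ideal_propM | rewrite mulrDr mulrA].
- by move=> [a [b [Ib e]]]; apply: no_a; exists a; rewrite e addrK.
Qed.

Lemma residue_field_exists (R : comNzRingType) :
  exists k : fieldType, inhabited {rmorphism R -> k}.
Proof.
have [I [I_id I_max]] := maximal_ideal_exists R.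
have [Q [f [f_surj f_ker]]] := quotient_ring_exists I_id.
have /choice[inv invP] : forall y : Q, exists z,
    (y != 0 -> z * y = 1) /\ (y = 0 -> z = 0).
  move=> y; have [-> | y_n0] := eqVneq y 0; first by exists 0.
  have [x xy] := f_surj y; have nIx : ~ I x.
    by move=> /f_ker fx0; rewrite -xy fx0 eqxx in y_n0.
  have [a /f_ker fa] := I_max x nIx; exists (f a).
  split=> [_|y0]; last by rewrite y0 eqxx in y_n0.
  by move/eqP: fa; rewrite rmorphB rmorph1 rmorphM /= xy subr_eq0 => /eqP.
have mulVf (x : Q) : x != 0 -> inv x * x = 1 by case: (invP x).
have inv0 : inv 0 = 0 by case: (invP 0) => _; apply.
pose fld := GRing.ComNzRing_isField.Build Q mulVf inv0.
exists (HB.pack_for fieldType Q fld); split.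
exact: f.
Qed.

(** * Invertible primes in finitely generated rings *)

Section PseudoDivision.
Variables (K : fieldType) (B : subringClosed K).

Lemma pseudo_division (q f : {poly K}) :
    q != 0 -> q \is a polyOver B -> f \is a polyOver B ->
  exists t g r, [/\ g \is a polyOver B, r \is a polyOver B,
    lead_coef q ^+ t *: f = g * q + r & (size r < size q)%N].
Proof.
move=> q_n0 Bq; have Bl : lead_coef q \in B by apply: (polyOverP Bq).
move: {2}(size f) (leqnn (size f)) => m; elim: m f => [|m IHm] f le_fm Bf.
  exists 0%N, 0, f; rewrite expr0 scale1r mul0r add0r rpred0; split=> //.
  by rewrite (leq_ltn_trans le_fm) // size_poly_gt0.
have [lt_fq | le_qf] := ltnP (size f) (size q).
  by exists 0%N, 0, f; rewrite expr0 scale1r mul0r add0r rpred0.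
pose mono := lead_coef f *: 'X^(size f - size q).
have Bmono : mono \is a polyOver B.
  by rewrite polyOverZ ?polyOverXn //; apply: (polyOverP Bf).
pose f' := lead_coef q *: f - mono * q.
have Bf' : f' \is a polyOver B by apply: rpredB; [apply: polyOverZ | apply: rpredM].
have f_n0 : f != 0 by rewrite -size_poly_gt0 (leq_trans _ le_qf) // size_poly_gt0.
have mono_n0 : mono != 0.
  by rewrite scaler_eq0 lead_coef_eq0 (negPf f_n0) -size_poly_eq0 size_polyXn.
have sz_mono : size (mono * q) = size f.
  rewrite size_mul // size_scale ?lead_coef_eq0 // size_polyXn addSn /=.
  by rewrite subnK.
have le_f'm : (size f' <= m)%N.
  rewrite -ltnS (leq_trans _ le_fm) // ltnNge; apply/negP => le_ff'.
  have : f'`_(size f).-1 = 0.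
    rewrite coefB coefZ -lead_coefE -sz_mono -lead_coefE lead_coefM.
    by rewrite lead_coefZ lead_coefXn mulr1 mulrC subrr.
  have sz_f' : size f' = size f.
    apply/eqP; rewrite eqn_leq le_ff' andbT (leq_trans (size_polyD _ _)) //.
    by rewrite size_polyN sz_mono geq_max leqnn size_scale_leq.
  move=> top0; have : lead_coef f' == 0 by rewrite lead_coefE sz_f' top0.
  by rewrite lead_coef_eq0 -size_poly_eq0 sz_f' size_poly_eq0 (negPf f_n0).
have [t [g [r [Bg Br e lt_r]]]] := IHm f' le_f'm Bf'.
exists t.+1, (g + lead_coef q ^+ t *: mono), r; split=> //.
  by rewrite rpredD // polyOverZ // rpredX.
rewrite exprSr -scalerA -[lead_coef q *: f](subrK (mono * q)) -/f' scalerDr e.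
rewrite [LHS]addrAC mulrDl; congr (_ + _ + _); exact: scalerAl.
Qed.
End PseudoDivision.

Section AdjoinOne.
Variables (K : fieldType) (B : subringClosed K) (c : K).

Definition adjoin_one : {pred K} :=
  fun x => `[< exists2 q : {poly K}, q \is a polyOver B & x = q.[c] >].

Lemma adjoin_oneP x :
  reflect (exists2 q : {poly K}, q \is a polyOver B & x = q.[c]) (x \in adjoin_one).
Proof. exact: asboolP. Qed.

Fact adjoin_one_closed : subring_closed adjoin_one.
Proof.
split=> [|_ _ /adjoin_oneP[q Bq ->] /adjoin_oneP[r Br ->]
         |_ _ /adjoin_oneP[q Bq ->] /adjoin_oneP[r Br ->]]; apply/adjoin_oneP.
- by exists 1; rewrite ?rpred1 ?hornerE.
- by exists (q - r); rewrite ?rpredB ?hornerE.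
- by exists (q * r); rewrite ?rpredM ?hornerE.
Qed.
HB.instance Definition _ :=
  GRing.isSubringClosed.Build K adjoin_one adjoin_one_closed.

Lemma adjoin_one_base x : x \in B -> x \in adjoin_one.
Proof.
by move=> Bx; apply/adjoin_oneP; exists x%:P; rewrite ?polyOverC ?hornerC.
Qed.

Lemma adjoin_one_gen : c \in adjoin_one.
Proof. by apply/adjoin_oneP; exists 'X; rewrite ?polyOverX ?hornerX. Qed.
End AdjoinOne.

(** Only finitely many primes become invertible in B[1/a], for each nonzero a.
    It is the localisation that makes the property pass from B to B[c] when c is
    algebraic, as c is integral only after inverting some element of B. *)
Definition few_prime_units (K : fieldType) (B : {pred K}) := forall a, a \in B -> a != 0 ->
  exists N, forall p, prime p -> (N < p)%N -> forall e x, x \in B -> x *+ p != a ^+ e.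

Section FewUnits.
Variables (K : fieldType) (charK : [pchar K] =i pred0).

Lemma natr_pchar0_eq0 m : (m%:R == 0 :> K) = (m == 0)%N.
Proof. by move/pcharf0P: charK => /(_ m). Qed.

Lemma intr_pchar0_inj : injective (intr : int -> K).
Proof.
move=> y z /eqP; rewrite -subr_eq0 -rmorphB => /eqP /= yz0.
apply/eqP; rewrite -subr_eq0; move: (y - z) yz0 => [] m /eqP.
  by rewrite natr_pchar0_eq0.
by rewrite NegzE rmorphN oppr_eq0 natr_pchar0_eq0.
Qed.

Definition int_pred : {pred K} := fun x => `[< exists z : int, x = z%:~R >].

Fact int_pred_closed : subring_closed int_pred.
Proof.
split=> [|_ _ /asboolP[y ->] /asboolP[z ->]|_ _ /asboolP[y ->] /asboolP[z ->]];
  apply/asboolP.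
- by exists 1.
- by exists (y - z); rewrite rmorphB.
- by exists (y * z); rewrite rmorphM.
Qed.
HB.instance Definition _ :=
  GRing.isSubringClosed.Build K int_pred int_pred_closed.

Lemma few_prime_units_int : few_prime_units int_pred.
Proof.
move=> _ /asboolP[z ->] z_n0; exists `|z|%N => p p_pr lt_p e _ /asboolP[y ->].
apply/eqP; rewrite -mulr_natr -[p%:R]/((p%:Z)%:~R) -rmorphM -rmorphXn /=.
move=> /intr_pchar0_inj /(congr1 absz); rewrite abszM abszX /= => yp.
have : (p %| `|z| ^ e)%N by rewrite -yp dvdn_mull.
rewrite Euclid_dvdX // => /andP[p_z _].
have z_gt0 : (0 < `|z|)%N by rewrite absz_gt0; apply: contra_neq z_n0 => ->.
by have := dvdn_leq z_gt0 p_z; rewrite leqNgt lt_p.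
Qed.

Section Step.
Variables (B : subringClosed K) (c : K).
Hypothesis fewB : few_prime_units B.

(** An equation p x = a^e in the polynomial ring B[c] restricts to the leading
    coefficients. *)
Lemma few_prime_units_transcendental :
    (forall q, q \is a polyOver B -> q.[c] = 0 -> q = 0) ->
  few_prime_units (adjoin_one B c).
Proof.
move=> c_tr _ /adjoin_oneP[q Bq ->] qc_n0.
have q_n0 : q != 0 by apply: contra_neq qc_n0 => ->; rewrite horner0.
have [|N NP] := fewB (a := lead_coef q) (polyOverP Bq _); first by rewrite lead_coef_eq0.
exists N => p p_pr lt_p e _ /adjoin_oneP[r Br ->]; apply/eqP => e_rq.
have : r *+ p - q ^+ e = 0.
  apply: c_tr; first by rewrite rpredB ?rpredMn ?rpredX.
  by rewrite !hornerE hornerMn ?horner_exp e_rq subrr.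
move/eqP; rewrite subr_eq0 => /eqP /(congr1 (fun f : {poly K} => f`_(size (q ^+ e)).-1)).
rewrite -lead_coefE lead_coef_exp coefMn => /eqP.
by apply/negP/NP => //; apply: (polyOverP Br).
Qed.

Section Algebraic.
Variable h : {poly K}.
Hypotheses (h_n0 : h != 0) (Bh : h \is a polyOver B) (hc : h.[c] = 0).
Hypothesis h_min :
  forall q, q \is a polyOver B -> q != 0 -> q.[c] = 0 -> (size h <= size q)%N.

(** Nonzero elements of B[c] have nonzero multiples in B: reduce q modulo h, then
    h modulo the remainder, and so on; the remainders have decreasing degree.  The degree of h
    being minimal, no nonzero polynomial of smaller degree vanishes at c. *)
Lemma adjoin_one_multiple q : q \is a polyOver B -> q.[c] != 0 ->
  exists v b, [/\ v \is a polyOver B, b \in B, b != 0 & v.[c] * q.[c] = b].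
Proof.
suff main m : forall q : {poly K},
    (size q <= m)%N -> (size q < size h)%N -> q \is a polyOver B ->
    q.[c] != 0 -> exists v b, [/\ v \is a polyOver B, b \in B, b != 0 & v.[c] * q.[c] = b].
  move=> Bq qc_n0.
  have [t [g [r [Bg Br e lt_r]]]] := pseudo_division h_n0 Bh Bq.
  have rE : lead_coef h ^+ t * q.[c] = r.[c].
    by rewrite -hornerZ e !hornerE hc mulr0 add0r.
  have lh_n0 : lead_coef h ^+ t != 0 by rewrite expf_neq0 // lead_coef_eq0.
  have [|v [b [Bv Bb b_n0 vr]]] := main _ r (leqnn _) lt_r Br.
    by rewrite -rE mulf_neq0.
  exists (lead_coef h ^+ t *: v), b; split=> //.
    by rewrite polyOverZ // rpredX // (polyOverP Bh).
  by rewrite hornerZ -mulrA mulrCA rE mulrC -vr mulrC.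
elim: m {q} => [|m IHm] q le_qm lt_qh Bq qc_n0.
  by move: le_qm qc_n0; rewrite size_poly_leq0 => /eqP ->; rewrite horner0 eqxx.
have q_n0 : q != 0 by apply: contra_neq qc_n0 => ->; rewrite horner0.
have [/size1_polyC qE | gt_q1] := leqP (size q) 1.
  exists 1, q`_0; rewrite rpred1 (polyOverP Bq) hornerC mul1r qE !hornerC coefC /=.
  by split=> //; apply: contra_neq qc_n0 => q0; rewrite qE q0 hornerC.
have [t [g [r [Bg Br e lt_r]]]] := pseudo_division q_n0 Bq Bh.
have grc : g.[c] * q.[c] + r.[c] = 0.
  by rewrite -hornerM -hornerD -e hornerZ hc mulr0.
have lq_n0 : lead_coef q ^+ t != 0 by rewrite expf_neq0 // lead_coef_eq0.
have g_n0 : g != 0.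
  apply: contraTneq lt_qh => g0; move: e; rewrite g0 mul0r add0r -leqNgt => rE.
  by rewrite -(size_scale h lq_n0) rE ltnW.
have sz_g : (size g < size h)%N.
  have le_rg : (size r < size (g * q)%R)%N.
    rewrite size_mul // (leq_trans lt_r) //.
    by rewrite (polySpred g_n0) addSn leq_addl.
  rewrite -(size_scale h lq_n0) e size_polyDl // size_mul //.
  case: (size q) gt_q1 => [|[|k]] // _; rewrite !addnS /= ltnS leq_addr //.
have gc_n0 : g.[c] != 0.
  by apply: contraTneq sz_g => gc0; rewrite -leqNgt h_min.
have rc_n0 : r.[c] != 0.
  move/eqP: grc; rewrite addrC addr_eq0 => /eqP ->.
  by rewrite oppr_eq0 mulf_neq0.
have [||v [b [Bv Bb b_n0 vr]]] := IHm r _ _ Br rc_n0.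
- by rewrite -ltnS (leq_trans lt_r).
- exact: ltn_trans lt_r lt_qh.
exists (- (v * g)), b; split=> //; first by rewrite rpredN rpredM.
rewrite hornerN hornerM -vr mulNr -mulrA -mulrN; congr (_ * _).
by apply/eqP; rewrite eq_sym -addr_eq0 addrC grc.
Qed.

(** If p divides a power of a, it divides a power of the multiple b of a that
    lies in B.  The quotient, multiplied by a power of l := lead_coef h, is a
    combination of the powers of c below the degree of h.  These are linearly
    independent over B, so p already divides a power of l b in B. *)
Lemma few_prime_units_algebraic : few_prime_units (adjoin_one B c).
Proof.
move=> _ /adjoin_oneP[q Bq ->] qc_n0.
have [v [b [Bv Bb b_n0 vq]]] := adjoin_one_multiple Bq qc_n0.
set l := lead_coef h.
have l_n0 : l != 0 by rewrite lead_coef_eq0.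
have Bl : l \in B by apply: (polyOverP Bh).
have [||N NP] := fewB (a := l * b); rewrite ?rpredM ?mulf_neq0 //.
exists N => p p_pr lt_p e _ /adjoin_oneP[r Br ->]; apply/eqP => rq.
have [t [g [y [Bg By yE lt_y]]]] := pseudo_division h_n0 Bh
  (rpredM (rpredX e Bv) Br : v ^+ e * r \is a polyOver B).
have yc : y.[c] *+ p = l ^+ t * b ^+ e.
  have -> : y.[c] = l ^+ t * (v ^+ e * r).[c].
    by rewrite -hornerZ yE !hornerE hc mulr0 add0r.
  by rewrite hornerM horner_exp -mulrnAr -mulrnAr rq -exprMn vq.
have h_gt1 : (1 < size h)%N.
  rewrite ltnNge; apply/negP => /size1_polyC hE; move: h_n0 hc.
  by rewrite hE hornerC => /eqP h0 h00; apply: h0; rewrite h00.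
have y0 : y *+ p = (l ^+ t * b ^+ e)%:P.
  apply: contrapT => /eqP; rewrite -subr_eq0 => d_n0.
  have := (fun Bd => h_min Bd d_n0); rewrite !hornerE hornerMn yc subrr.
  rewrite rpredB ?rpredMn ?polyOverC ?rpredM ?rpredX // => /(_ isT erefl).
  rewrite leqNgt => /negP; apply; apply: leq_ltn_trans (size_polyD _ _) _.
  rewrite size_polyN gtn_max (leq_ltn_trans (size_polyC_leq1 _)) // andbT.
  by apply: leq_ltn_trans lt_y; rewrite -mulr_natr -polyC_natr mulrC mul_polyC size_scale_leq.
(* The extra factor gives l and b the same exponent. *)
have := congr1 (fun f : {poly K} => f`_0 * (l ^+ e * b ^+ t)) y0.
rewrite coefMn coefC /= mulrnAl mulrACA -!exprD (addnC e t) -exprMn => /eqP.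
by apply/negP/NP => //; rewrite rpredM ?rpredX ?rpredM ?rpredX // (polyOverP By).
Qed.
End Algebraic.

Lemma few_prime_units_adjoin : few_prime_units (adjoin_one B c).
Proof.
pose alg_of m := `[< exists q, [/\ q \is a polyOver B, q != 0, q.[c] = 0 & size q = m] >].
have [ex_alg | no_alg] := pselect (exists m, alg_of m).
  have [_ /asboolP[h [Bh h_n0 hc <-]] h_min] := ex_minnP ex_alg.
  apply: (few_prime_units_algebraic h_n0 Bh hc) => q Bq q_n0 qc.
  by apply: h_min; apply/asboolP; exists q.
apply: few_prime_units_transcendental => q Bq qc; apply: contrapT => /eqP q_n0.
by apply: no_alg; exists (size q); apply/asboolP; exists q.
Qed.
End Step.

Lemma few_prime_units_fg (cs : seq K) :
  exists B : subringClosed K, few_prime_units B /\ {subset cs <= B}.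
Proof.
elim: cs => [|c cs [B [fewB csB]]].
  pose B0 : subringClosed K := HB.pack_for (subringClosed K) int_pred
    (GRing.isSubringClosed.Build K int_pred int_pred_closed).
  by exists B0; split=> //; apply: few_prime_units_int.
pose B' : subringClosed K := HB.pack_for (subringClosed K) (adjoin_one B c)
  (GRing.isSubringClosed.Build K (adjoin_one B c) (@adjoin_one_closed K B c)).
exists B'; split; first exact: few_prime_units_adjoin.
move=> x; rewrite inE => /predU1P[-> | /csB]; first exact: adjoin_one_gen.
exact: adjoin_one_base.
Qed.
End FewUnits.

Section SubringType.
Variables (K : fieldType) (B : subringClosed K).

Record subring_type := SubringElt { subring_val : K; _ : subring_val \in B }.
HB.instance Definition _ := [isSub for subring_val].
HB.instance Definition _ := [Choice of subring_type by <:].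
HB.instance Definition _ := [SubChoice_isSubComNzRing of subring_type by <:].

Definition subring_incl : {rmorphism subring_type -> K} := val.

End SubringType.

(** * Skew operators with a Weyl partner *)

Lemma degree_bound (R : comNzRingType) (x : diffop R) :
  exists N, forall M, (N <= M)%N -> vdeg_le M x /\ udeg_le M x.
Proof.
exists (size (x : {poly {poly R}})
  + \sum_(j < size (x : {poly {poly R}})) size (opcoef x j))%N.
move=> M le_M; split=> j.
  move=> lt_Mj; rewrite /opcoef nth_default //.
  by rewrite ltnW // (leq_ltn_trans _ lt_Mj) // (leq_trans _ le_M) // leq_addr.
rewrite leqW // (leq_trans _ le_M) //.
have [lt_j | le_j] := ltnP j (size (x : {poly {poly R}})).
  by rewrite (bigD1 (Ordinal lt_j)) //= addnCA leq_addr.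
by rewrite /opcoef nth_default // size_poly0.
Qed.

Lemma diffop_lift (A K : comNzRingType) (f : {rmorphism A -> K}) (x : diffop K) N :
    vdeg_le N x -> udeg_le N x ->
    (forall j i, (j <= N)%N -> (i <= N)%N -> exists a, f a = (opcoef x j)`_i) ->
  exists y, map_op f y = x.
Proof.
move=> le_v le_u x_f.
have /choice[a aP] : forall ji : nat * nat, exists a, (ji.1 <= N)%N -> (ji.2 <= N)%N ->
    f a = (opcoef x ji.1)`_ji.2.
  move=> [j i] /=; have [le_j|_] := leqP j N; last by exists 0.
  have [le_i|_] := leqP i N; last by exists 0.
  by have [a e] := x_f j i le_j le_i; exists a.
exists (\poly_(j < N.+1) \poly_(i < N.+1) a (j, i)).
apply/diffopP=> j; apply/polyP=> i; rewrite opcoef_map coef_map /opcoef coef_poly.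
case: ltnP => [lt_j | le_j]; last by rewrite coef0 raddf0 -/(opcoef x j) le_v // coef0.
rewrite coef_poly; case: ltnP => [lt_i | le_i]; first exact: aP.
by rewrite raddf0 nth_default // (leq_trans (le_u j)).
Qed.

Lemma prime_quotient_field (A : comNzRingType) p : prime p -> (forall x : A, x *+ p <> 1) ->
  exists (R : comNzRingType) (f : {rmorphism A -> R}) (k : fieldType) (g : {rmorphism R -> k}),
    [/\ p \in [pchar R], forall y, exists x, f x = y
      & forall x, f x = 0 -> exists y, x = y *+ p].
Proof.
move=> p_pr p_nonunit; have [R [f [f_surj f_ker]]] := quotient_by_nat p_nonunit.
have [k [g]] := residue_field_exists R; exists R, f, k, g; split=> // [|x /f_ker //].
rewrite inE p_pr -(rmorph1 f) -rmorphMn; apply/eqP/f_ker.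
by exists 1.
Qed.

Section SkewPartner.
Variables (K : fieldType) (charK : [pchar K] =i pred0).

(** A finite set of elements of K lies in a subring A that has a nonzero
    reduction modulo some large prime.  The reduction R is A / p itself, which
    may have nilpotents: dividing commutators by p requires the kernel to be
    exactly p A.  The field k is a further quotient of R. *)
Lemma prime_specialization (cs : seq K) N :
  exists (n : nat) (A R : comNzRingType) (k : fieldType)
    (i : {rmorphism A -> K}) (f : {rmorphism A -> R}) (g : {rmorphism R -> k}),
    [/\ injective i, forall x, x \in cs -> exists a, i a = x,
        (N < n.+1)%N & [/\ n.+1 \in [pchar R], odd n.+1,
        forall y, exists x, f x = y
      & forall x, f x = 0 -> exists y, x = y *+ n.+1]].
Proof.
have [B [fewB csB]] := few_prime_units_fg charK cs.
have [||N0 N0P] := fewB 1; rewrite ?rpred1 ?oner_neq0 //.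
have [p lt_p p_pr] := prime_above (maxn N (maxn N0 2)).
move: lt_p; rewrite !gtn_max => /and3P[lt_Np lt_N0p lt_2p].
case: p p_pr lt_Np lt_N0p lt_2p => // n p_pr lt_Np lt_N0p lt_2p.
pose A : comNzRingType := subring_type B.
have nonunit (x : A) : x *+ n.+1 <> 1.
  move/(congr1 (subring_incl B)); rewrite rmorphMn rmorph1 /= => /eqP.
  by apply/negP; rewrite -(expr0 1); apply: N0P => //; apply: valP.
have [R [f [k [g [pR f_surj f_ker]]]]] := prime_quotient_field p_pr nonunit.
exists n, A, R, k, (subring_incl B), f, g; split=> //.
- exact: val_inj.
- by move=> x /csB Bx; exists (SubringElt Bx).
- by split=> //; case: (even_prime p_pr) => // p2; rewrite p2 in lt_2p.
Qed.

(** The leading coefficient of D is made invertible in A, so that the order of D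
    and the degree of its leading coefficient survive the reduction. *)
Theorem skew_partner_order_one (D S : diffop K) :
  D * S - S * D = 1 -> op_adj D = - D -> exists2 c : K, c != 0 & D = c *: opV K.
Proof.
move=> DS D_adj.
have D_n0 : (D : {poly {poly K}}) != 0.
  apply: contra_eq_neq DS => D0; rewrite (D0 : D = 0) mul0r mulr0 subrr.
  by rewrite eq_sym oner_neq0.
pose m := (size (D : {poly {poly K}})).-1; pose a := opcoef D m.
have a_n0 : a != 0 by rewrite -[a]/(lead_coef (D : {poly {poly K}})) lead_coef_eq0.
have [N1 N1P] := degree_bound D; have [N2 N2P] := degree_bound S.
pose N := maxn N1 N2.
have [D_v D_u] := N1P N (leq_maxl _ _); have [S_v S_u] := N2P N (leq_maxr _ _).
pose coefs (x : diffop K) :=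
  flatten [seq [seq (opcoef x j)`_i | i <- iota 0 N.+1] | j <- iota 0 N.+1].
have coefsP x j i : (j <= N)%N -> (i <= N)%N -> (opcoef x j)`_i \in coefs x.
  move=> le_j le_i; apply/flattenP; exists [seq (opcoef x j)`_i' | i' <- iota 0 N.+1].
    by apply/mapP; exists j; rewrite // mem_iota ltnS.
  by apply/mapP; exists i; rewrite // mem_iota ltnS.
have [n [A [R [k [iota_ [f [g [i_inj liftP lt_p [pR odd_p f_surj f_ker]]]]]]]]] :=
  prime_specialization ((lead_coef a)^-1 :: coefs D ++ coefs S) (N.+1 * N.+1).
have [DA DAE] : exists y, map_op iota_ y = D.
  apply: (diffop_lift D_v D_u) => j i le_j le_i; apply: liftP.
  by rewrite inE mem_cat coefsP ?orbT.
have [SA SAE] : exists y, map_op iota_ y = S.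
  apply: (diffop_lift S_v S_u) => j i le_j le_i; apply: liftP.
  by rewrite inE mem_cat coefsP ?orbT.
have [b bE] := liftP _ (mem_head _ _).
have p_tf (x : A) : x *+ n.+1 = 0 -> x = 0.
  move/(congr1 iota_); rewrite rmorphMn rmorph0 /= -mulr_natr => /eqP.
  rewrite mulf_eq0 (natr_pchar0_eq0 charK) orbF => /eqP x0.
  by apply: i_inj; rewrite x0 rmorph0.
have DSA : DA * SA - SA * DA = 1.
  by apply: (map_op_inj i_inj); rewrite rmorphB !rmorphM /= DAE SAE DS rmorph1.
have DA_adj : op_adj DA = - DA.
  by apply: (map_op_inj i_inj); rewrite map_op_adj rmorphN /= DAE.
have v_A x M : vdeg_le M (map_op iota_ x) -> vdeg_le M x.
  move=> le_x j /le_x; rewrite opcoef_map -(rmorph0 (map_poly iota_)).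
  exact: (map_inj_poly i_inj (rmorph0 _)).
have u_A x : udeg_le N (map_op iota_ x) -> udeg_le N x.
  by move=> le_x j; have := le_x j; rewrite opcoef_map (size_map_inj_poly i_inj (rmorph0 _)).
have D_m : vdeg_le m (map_op iota_ DA).
  by move=> j lt_mj; rewrite DAE /opcoef nth_default // (polySpred D_n0).
pose l := (opcoef DA m)`_(size a).-1.
have lE : iota_ l = lead_coef a by rewrite -coef_map -opcoef_map DAE lead_coefE.
have lb : l * b = 1.
  by apply: i_inj; rewrite rmorphM rmorph1 /= lE bE divff // lead_coef_eq0.
have gfl : (opcoef (map_op g (map_op f DA)) m)`_(size a).-1 != 0.
  rewrite !opcoef_map !coef_map -/l; apply/eqP => gfl0.
  have : g (f (l * b)) = 0 by rewrite !rmorphM /= gfl0 mul0r.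
  by rewrite lb !rmorph1 => /eqP; rewrite oner_eq0.
have DA_v : vdeg_le N DA by apply: v_A; rewrite DAE.
have DA_u : udeg_le N DA by apply: u_A; rewrite DAE.
have SA_v : vdeg_le N SA by apply: v_A; rewrite SAE.
have SA_u : udeg_le N SA by apply: u_A; rewrite SAE.
have [||m1 sz1] := charp_rigidity (k := k) (g := g) (m := m) pR f_surj f_ker p_tf odd_p lt_p
  DSA DA_adj DA_v DA_u SA_v SA_u.
- by move=> j lt_mj; rewrite !opcoef_map (v_A _ _ D_m) // !rmorph0.
- by apply: contra_neq gfl => ->; rewrite coef0.
have sz_a : size a = 1%N.
  suff e0 : (size a).-1 = 0%N by rewrite (polySpred a_n0) e0.
  apply/eqP; rewrite -leqn0 -ltnS ltnNge.
  by apply: contra gfl => le_a; rewrite nth_default // sz1.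
have [c aE] : exists c, a = c%:P by exists a`_0; apply/size1_polyC; rewrite sz_a.
have [d DE] : exists d, D = opC c%:P * opV K + opC d.
  exists (opcoef D 0).
  apply/diffopP => j; rewrite opcoefD opcoef_mulV opcoefC.
  rewrite opcoefC; case: j => [|[|j]] /=; rewrite ?add0r ?addr0 //.
    by rewrite -aE /a m1.
  by rewrite -DAE D_m // m1.
exists c; first by apply: contra_neq a_n0 => c0; rewrite aE c0 polyC0.
have adjE : op_adj D = opC d - opC c%:P * opV K.
  rewrite DE op_adjD op_adjM op_adjV !op_adjC mulNr opV_commC derivC.
  by rewrite raddf0 addr0 addrC.
have d0 : d = 0.
  have : opC d *+ 2 = 0.
    have : op_adj D + D = 0 by rewrite D_adj addNr.
    by rewrite adjE DE addrA subrK -mulr2n.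
  move=> d2; apply/polyP => i.
  have := congr1 (fun x : diffop K => (opcoef x 0%N)`_i) d2.
  rewrite opcoefMn opcoefC coefMn /opcoef !coef0 -mulr_natr => /eqP.
  by rewrite mulf_eq0 (natr_pchar0_eq0 charK) orbF => /eqP.
rewrite DE d0 raddf0 addr0 -[c%:P]alg_polyC linearZ /= rmorph1 -scalerAl mul1r //.
Qed.
End SkewPartner.

(** * Endomorphisms commuting with the exchange *)

Lemma rmorph_horner_alg (K : comNzRingType) (A B : algType K) (f : {lrmorphism A -> B})
  (a : A) (t : {poly K}) : f (horner_alg a t) = horner_alg (f a) t.
Proof.
elim/poly_ind: t => [|t c IHt]; first by rewrite !rmorph0.
rewrite !(rmorphD, rmorphM) /= !horner_algX !horner_algC IHt.
by rewrite linearZ /= rmorph1.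
Qed.

Definition pack_lrmorphism (K : pzRingType) (A B : algType K) (f : A -> B)
    (f_lin : linear f) (f_mon : monoid_morphism f) : {lrmorphism A -> B} :=
  HB.pack_for {lrmorphism A -> B} f
    (GRing.isLinear.Build K A B *:%R f f_lin) (GRing.isMonoidMorphism.Build A B f f_mon).

Lemma comm_sub_add (R : pzRingType) (a b : R) :
  (b - a) * (a + b) - (a + b) * (b - a) = (b * a - a * b) + (b * a - a * b).
Proof.
have -> : (b - a) * (a + b) = (b * a - a * b) + (b * b - a * a).
  by rewrite mulrBl !mulrDr opprD (addrC (- (a * a))) addrACA.
have -> : (a + b) * (b - a) = - (b * a - a * b) + (b * b - a * a).
  by rewrite mulrDl !mulrBr opprB addrACA [RHS]addrACA (addrC (- (a * a))).
by rewrite opprD opprK addrACA subrr addr0.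
Qed.

Section WeylDiffop.
Variables (K : fieldType) (charK : [pchar K] =i pred0).
Local Notation A1 := (weyl K).
Local Notation W := (diffop K).

(** Generators adapted to the exchange: it fixes the first and negates the
    second. *)
Definition weylU : A1 := weylX K + weylY K.
Definition weylV : A1 := 2%:R^-1 *: (weylY K - weylX K).

Lemma half2 : (2%:R^-1 + 2%:R^-1 : K) = 1.
Proof.
have two_n0 : 2%:R != 0 :> K by rewrite (natr_pchar0_eq0 charK).
by rewrite -mulr2n -(mulr_natr 2%:R^-1) mulVf.
Qed.

Lemma weylVU : weylV * weylU - weylU * weylV = 1.
Proof.
rewrite /weylV /weylU -scalerAl -scalerAr -scalerBr.
by rewrite comm_sub_add (weyl_relation K) scalerDr -scalerDl half2 scale1r.
Qed.

Lemma weylX_UV : weylX K = 2%:R^-1 *: weylU - weylV.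
Proof.
rewrite -scalerBr opprB addrACA subrr addr0 -mulr2n -scaler_nat scalerA mulVf ?scale1r //.
by rewrite (natr_pchar0_eq0 charK).
Qed.

Lemma weylY_UV : weylY K = 2%:R^-1 *: weylU + weylV.
Proof.
rewrite -scalerDr /weylU (addrC (weylX K)) addrACA subrr addr0 -mulr2n.
rewrite -scaler_nat scalerA mulVf ?scale1r //.
by rewrite (natr_pchar0_eq0 charK).
Qed.

Lemma weyl_morph_uniqueUV (B : algType K) (f g : {lrmorphism A1 -> B}) :
  f weylU = g weylU -> f weylV = g weylV -> f =1 g.
Proof.
move=> eqU eqV.
have kX (k : {lrmorphism A1 -> B}) :
    k (weylX K) = 2%:R^-1 *: k weylU - k weylV.
  by rewrite {1}weylX_UV raddfB /= [k (_ *: _)]linearZ.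
have kY (k : {lrmorphism A1 -> B}) :
    k (weylY K) = 2%:R^-1 *: k weylU + k weylV.
  by rewrite {1}weylY_UV raddfD /= [k (_ *: _)]linearZ.
by apply: weyl_morph_unique; rewrite ?kX ?kY eqU eqV.
Qed.

Let opX : W := 2%:R^-1 *: opU K - opV K.
Let opY : W := 2%:R^-1 *: opU K + opV K.

Lemma opYX : opY * opX - opX * opY = 1.
Proof.
have := opVU K; set u := opU K; set v := opV K => vu.
rewrite /opY /opX; set a := 2%:R^-1 *: u.
rewrite (addrC a v) -[LHS]opprB comm_sub_add opprD !opprB.
by rewrite -scalerAl -scalerAr -scalerBr vu -scalerDl half2 scale1r.
Qed.

Definition weyl_diffop : {lrmorphism A1 -> W} :=
  pack_lrmorphism (weyl_eval_linear opYX) (weyl_eval_multiplicative opYX).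

Lemma weyl_diffopX : weyl_diffop (weylX K) = opX.
Proof. exact: (weyl_evalX opYX). Qed.

Lemma weyl_diffopY : weyl_diffop (weylY K) = opY.
Proof. exact: (weyl_evalY opYX). Qed.

Lemma weyl_diffopU : weyl_diffop weylU = opU K.
Proof.
have -> : weyl_diffop weylU = weyl_diffop (weylX K) + weyl_diffop (weylY K).
  exact: raddfD.
rewrite weyl_diffopX weyl_diffopY addrACA addNr addr0.
by rewrite -scalerDl half2 scale1r.
Qed.

Lemma weyl_diffopV : weyl_diffop weylV = opV K.
Proof.
have -> : weyl_diffop weylV = 2%:R^-1 *: (weyl_diffop (weylY K) - weyl_diffop (weylX K)).
  by rewrite -raddfB -linearZ.
rewrite weyl_diffopX weyl_diffopY opprB addrACA.
rewrite (addrC (opV K)) addrACA subrr add0r -mulr2n -scaler_nat scalerA mulVf ?scale1r //.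
by rewrite (natr_pchar0_eq0 charK).
Qed.

Definition diffop_weyl : {lrmorphism W -> A1} :=
  pack_lrmorphism (@op_eval_linear K A1 weylU weylV) (op_eval_multiplicative weylVU).

Lemma diffop_weylE x : diffop_weyl x = op_eval weylU weylV x.
Proof. by []. Qed.

Lemma weyl_diffopK a : diffop_weyl (weyl_diffop a) = a.
Proof.
apply: (weyl_morph_uniqueUV (f := diffop_weyl \o weyl_diffop) (g := idfun)).
  by rewrite -[LHS]/(diffop_weyl (weyl_diffop weylU)) weyl_diffopU diffop_weylE op_evalU.
by rewrite -[LHS]/(diffop_weyl (weyl_diffop weylV)) weyl_diffopV diffop_weylE op_evalV.
Qed.

Lemma exchangeU : exchange weylU = weylU.
Proof.
rewrite /weylU -[weylX K in LHS]scale1r exchange_linear exchangeX exchangeY scale1r.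
exact: addrC.
Qed.

Lemma exchangeV : exchange weylV = - weylV.
Proof.
have exZ k a : exchange (k *: a) = k *: exchange a :> A1.
  have e0 : exchange 0 = 0 :> A1.
    by have := @exchange_linear K (-1) 0 0; rewrite scaler0 add0r scaleN1r addNr.
  by rewrite -[k *: a]addr0 exchange_linear e0 addr0.
rewrite exZ -scaleN1r addrC exchange_linear exchangeX exchangeY scaleN1r.
by rewrite -scalerN opprB addrC.
Qed.

End WeylDiffop.

Section ExchangeEndomorphisms.
Variables (K : fieldType) (charK : [pchar K] =i pred0).
Local Notation A1 := (weyl K).
Local Notation W := (diffop K).
Local Notation phi := (weyl_diffop charK).
Local Notation psi := (diffop_weyl charK).

(** Both sides are morphisms to the converse ring, equal on the generators. *)
Lemma weyl_diffop_exchange (a : A1) : phi (exchange a) = op_adj (phi a).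
Proof.
pose f1 (x : A1) : W^c := phi (exchange x).
pose f2 (x : A1) : W^c := op_adj (phi x).
have f1_lin : linear f1 by move=> k x y; rewrite /f1 exchange_linear linearP.
have f1_mon : monoid_morphism f1.
  by split=> [|x y]; rewrite /f1 ?exchange1 ?rmorph1 // exchangeM rmorphM.
have f2_lin : linear f2 by move=> k x y; rewrite /f2 linearP /op_adj [LHS]linearP.
have f2_mon : monoid_morphism f2.
  by split=> [|x y]; rewrite /f2 ?rmorph1 ?op_adj1 // rmorphM op_adjM.
apply: (weyl_morph_uniqueUV charK (f := pack_lrmorphism f1_lin f1_mon)
  (g := pack_lrmorphism f2_lin f2_mon)).
  rewrite -[LHS]/(phi (exchange (weylU K))) -[RHS]/(op_adj (phi (weylU K))).
  by rewrite exchangeU weyl_diffopU op_adjU.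
rewrite -[LHS]/(phi (exchange (weylV K))) -[RHS]/(op_adj (phi (weylV K))).
rewrite exchangeV weyl_diffopV op_adjV -[in RHS](weyl_diffopV charK).
exact: (raddfN phi (weylV K)).
Qed.

Lemma commV_poly (T : W) : opV K * T = T * opV K ->
  exists t : {poly K}, psi T = horner_alg (weylV K) t.
Proof.
move=> VT; have T_const j : (opcoef T j)^`() = 0.
  have /diffopP/(_ j) := VT; rewrite opcoef_Vmul opcoef_mulV.
  by move/(canRL (addKr _)); rewrite addNr.
exists (\poly_(j < size (T : {poly {poly K}})) (opcoef T j)`_0).
rewrite diffop_weylE /op_eval poly_def raddf_sum; apply: eq_bigr => j _ /=.
rewrite linearZ rmorphXn /= horner_algX.
have -> : opcoef T j = ((opcoef T j)`_0)%:P.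
  apply/polyP=> -[|i]; rewrite coefC //=.
  have /polyP/(_ i) := T_const j; rewrite coef_deriv coef0 -mulr_natr => /eqP.
  by rewrite mulf_eq0 (natr_pchar0_eq0 charK) orbF => /eqP.
by rewrite horner_algC coefC /= mulr_algl.
Qed.

(** Such an f has the form v |-> c v, u |-> u / c + t(v), which is inverted by
    v |-> v / c, u |-> c (u - t(v / c)). *)
Theorem exchange_endomorphism_bijective (f : {lrmorphism A1 -> A1}) :
  (forall x, f (exchange x) = exchange (f x)) -> bijective f.
Proof.
move=> f_ex.
set u := weylU K; set v := weylV K.
have vu : v * u - u * v = 1 := weylVU charK.
have DS : f v * f u - f u * f v = 1 by rewrite -!rmorphM -rmorphB vu rmorph1.
have DS' : phi (f v) * phi (f u) - phi (f u) * phi (f v) = 1.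
  by rewrite -(rmorph1 phi) -DS rmorphB !rmorphM.
have D_adj : op_adj (phi (f v)) = - phi (f v).
  by rewrite -weyl_diffop_exchange -f_ex exchangeV !raddfN.
have [c c_n0 phiD] := skew_partner_order_one charK DS' D_adj.
have fv : f v = c *: v.
  rewrite -[LHS](weyl_diffopK charK) phiD linearZ; congr (_ *: _).
  by rewrite -[LHS]/(psi (opV K)) diffop_weylE op_evalV.
pose T : W := phi (f u) - c^-1 *: opU K.
have VT : opV K * T = T * opV K.
  apply/eqP; rewrite -subr_eq0; apply/eqP.
  rewrite /T mulrBr mulrBl opprB [X in _ + X]addrC addrACA -scalerAl -scalerAr.
  have -> : opV K * phi (f u) - phi (f u) * opV K = c^-1%:A.
    rewrite -[LHS]scale1r -(mulVf c_n0) -scalerA scalerBr scalerAl scalerAr.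
    by rewrite -phiD DS'.
  rewrite [X in _ + X]addrC -scalerBr -[opU K * _ - _]opprB opVU.
  by rewrite scalerN subrr.
have [t psiT] := commV_poly VT.
have fu : f u = c^-1 *: u + horner_alg v t.
  have -> : horner_alg v t = psi (phi (f u)) - c^-1 *: psi (opU K).
    by rewrite -psiT -linearZ -raddfB.
  rewrite weyl_diffopK.
  have -> : psi (opU K) = u by rewrite diffop_weylE op_evalU.
  by rewrite addrC subrK.
pose v' := c^-1 *: v; pose u' := c *: (u - horner_alg v' t).
have v'u' : v' * u' - u' * v' = 1.
  have v'_comm : v' * horner_alg v' t = horner_alg v' t * v'.
    elim/poly_ind: (t) => [|s k IHs]; first by rewrite !rmorph0 mulr0 mul0r.
    rewrite rmorphD rmorphM /= horner_algX horner_algC mulrDr mulrDl mulrA IHs.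
    by rewrite mulr_algr mulr_algl.
  have v'u : v' * u - u * v' = c^-1%:A.
    by rewrite -(scalerAl c^-1 v u) -(scalerAr c^-1 u v) -scalerBr vu.
  rewrite -(scalerAr c v') -(scalerAl c _ v') -scalerBr mulrBr mulrBl v'_comm.
  by rewrite opprB addrA addrNK v'u scalerA divff // scale1r.
pose e : {lrmorphism A1 -> A1} :=
  pack_lrmorphism (@op_eval_linear K A1 u' v') (op_eval_multiplicative v'u') \o phi.
have eE x : e x = op_eval u' v' (phi x) by [].
have eu : e u = u' by rewrite eE weyl_diffopU op_evalU.
have ev : e v = v' by rewrite eE weyl_diffopV op_evalV.
exists e => x.
  apply: (weyl_morph_uniqueUV charK (f := e \o f) (g := idfun)).
    have eh : e (horner_alg v t) = horner_alg v' t by rewrite -ev rmorph_horner_alg.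
    have efu : e (f u) = c^-1 *: e u + e (horner_alg v t) by rewrite fu; exact: linearP.
    by rewrite -[LHS]/(e (f u)) efu eh eu scalerA mulVf // scale1r subrK.
  have efv : e (f v) = c *: e v by rewrite fv; exact: linearZ.
  by rewrite -[LHS]/(e (f v)) efv ev scalerA divff // scale1r.
have fv' : f v' = v.
  have -> : f v' = c^-1 *: f v by exact: linearZ.
  by rewrite fv scalerA mulVf // scale1r.
apply: (weyl_morph_uniqueUV charK (f := f \o e) (g := idfun)).
  have feu : f (e u) = c *: (f u - f (horner_alg v' t)).
    by rewrite eu -raddfB -linearZ.
  rewrite -[LHS]/(f (e u)) feu rmorph_horner_alg fv' fu addrK.
  by rewrite scalerA divff // scale1r.
by rewrite -[LHS]/(f (e v)) ev.
Qed.

End ExchangeEndomorphisms.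

Section Conjugation.
Variable K : fieldType.
Local Notation A1 := (weyl K).

(** An anti-automorphism g may be replaced by exchange o g, as the exchange is an
    involution. *)
Lemma conjugate_exchange_automorphism (gamma : A1 -> A1) :
    conjugate_to (@exchange K) gamma ->
  exists g ginv : A1 -> A1, [/\ algebra_automorphism g, cancel g ginv, cancel ginv g
    & gamma =1 ginv \o @exchange K \o g].
Proof.
move=> [g [ginv [[g_auto | [g_lin g1 gM g_bij]] gK ginvK gE]]]; first by exists g, ginv.
exists (@exchange K \o g), (ginv \o @exchange K); split.
- split=> [k x y||x y|].
  + by rewrite /= g_lin exchange_linear.
  + by rewrite /= g1 exchange1.
  + by rewrite /= gM exchangeM.
  + exact: (bij_comp (inv_bij (@exchangeK K)) g_bij).
- by move=> x; rewrite /= exchangeK gK.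
- by move=> x; rewrite /= ginvK exchangeK.
- by move=> x; rewrite gE /= exchangeK.
Qed.

End Conjugation.

Lemma automorphism_inverse (K : fieldType) (A : algType K) (g ginv : A -> A) :
  algebra_automorphism g -> cancel g ginv -> cancel ginv g -> algebra_automorphism ginv.
Proof.
move=> [g_lin g1 gM g_bij] gK ginvK; split.
- by move=> k x y; apply: (can_inj gK); rewrite g_lin !ginvK.
- by apply: (can_inj gK); rewrite ginvK g1.
- by move=> x y; apply: (can_inj gK); rewrite gM !ginvK.
- by exists g.
Qed.

Theorem theorem2p8 (K : fieldType) (charK : [pchar K] =i pred0) :
  (forall f : {lrmorphism weyl K -> weyl K}, algebra_automorphism f)
  <->
  (forall f : {lrmorphism weyl K -> weyl K},
     exists gamma delta : weyl K -> weyl K,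
       [/\ is_involution gamma,
           is_involution delta,
           conjugate_to (@exchange K) gamma,
           conjugate_to (@exchange K) delta
         & f \o gamma =1 delta \o f]).
Proof.
split=> [dixmier f | gamma_delta f].
  have f_auto := dixmier f; have [f_lin f1 fM [finv fK finvK]] := f_auto.
  have finv_auto := automorphism_inverse f_auto fK finvK.
  have [finv_lin finv1 finvM finv_bij] := finv_auto.
  exists (@exchange K), (f \o @exchange K \o finv).
  have id_auto : @algebra_automorphism K (weyl K) id by split=> //; exists id.
  split.
  - exact: exchange_is_involution.
  - split; first split.
    + by move=> k x y; rewrite /= finv_lin exchange_linear f_lin.
    + by rewrite /= finv1 exchange1 f1.
    + by move=> x y; rewrite /= finvM exchangeM fM.
    + apply: bij_comp finv_bij; apply: bij_comp (inv_bij (@exchangeK K)).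
      by exists finv.
    + by move=> x; rewrite /= fK exchangeK finvK.
    + move=> f_id; have [_ _ ex_id] := exchange_is_involution K; apply: ex_id => x.
      by apply: (can_inj fK); have := f_id (f x); rewrite /= fK.
  - by exists id, id; split=> //; left.
  - by exists finv, f; split=> //; left.
  - by move=> x; rewrite /= fK.
have [gamma [delta [_ _ gammaC deltaC f_gd]]] := gamma_delta f.
have [g [ginv [g_auto gK ginvK gE]]] := conjugate_exchange_automorphism gammaC.
have [h [hinv [h_auto hK hinvK hE]]] := conjugate_exchange_automorphism deltaC.
have [gi_lin gi1 giM gi_bij] := automorphism_inverse g_auto gK ginvK.
have [h_lin h1 hM h_bij] := h_auto.
pose F := h \o f \o ginv.
have F_lin : linear F by move=> k x y; rewrite /F /= gi_lin linearP h_lin.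
have F_mon : monoid_morphism F.
  by split=> [|x y]; rewrite /F /= ?gi1 ?rmorph1 // giM rmorphM hM.
have F_bij : bijective F.
  apply: (exchange_endomorphism_bijective charK (f := pack_lrmorphism F_lin F_mon)) => x.
  rewrite -[LHS]/(h (f (ginv (exchange x)))) -[RHS]/(exchange (h (f (ginv x)))).
  have := f_gd (ginv x); rewrite /= gE hE /= ginvK => ->.
  by rewrite hinvK.
split; [exact: linearP | exact: rmorph1 | exact: rmorphM |].
have hinv_bij : bijective hinv by exists h.
have g_bij : bijective g by exists ginv.
apply: (eq_bij (bij_comp hinv_bij (bij_comp F_bij g_bij))) => x.
by rewrite /F /= gK hK.
Qed.
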